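(* Let $(M,g)$ be a smooth closed Riemannian manifold of dimension $n\ge 3$. There exist constants $C_1,C_2>0$ depending only on $(M,g)$ such that, for all sufficiently large $\lambda$, every eigenfunction $\varphi_\lambda$ of the Laplace operator of $(M,g)$ with eigenvalue $\lambda$ has a nodal domain $\Omega^*_{\varphi_\lambda}$ satisfying $$\frac{C_1}{\sqrt{\lambda}}\le\operatorname{inrad}(\Omega^*_{\varphi_\lambda})\le\frac{C_2}{\sqrt{\lambda}}.$$
   Context: A closed manifold is compact without boundary. An eigenfunction is a real-valued, not identically zero solution of $\Delta\varphi_\lambda+\lambda\varphi_\lambda=0$ on $M$ ($\Delta=\operatorname{div}\nabla$). A nodal domain is a connected component of $M\setminus\varphi_\lambda^{-1}(0)$. The inner radius $\operatorname{inrad}(\Omega)$ is the radius of the largest geodesic ball contained in $\Omega$ (the supremum of such radii). *)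

(* Defs.v *)
From HB Require Import structures.
From mathcomp Require Import all_boot all_order all_algebra.
From mathcomp Require Import all_classical all_reals all_analysis.

Set Implicit Arguments.
Unset Strict Implicit.
Unset Printing Implicit Defensive.

Import Order.TTheory GRing.Theory Num.Theory.
Import numFieldNormedType.Exports.

Local Open Scope classical_set_scope.
Local Open Scope ring_scope.

Section EuclideanCalculus.
Variables (R : realType) (n : nat).
Implicit Types (U : set 'rV[R]_n) (f : 'rV[R]_n -> R).

Definition partial (i : 'I_n) f : 'rV[R]_n -> R :=
  fun x => 'D_(delta_mx 0 i) f x.

Fixpoint iter_partial (s : seq 'I_n) f : 'rV[R]_n -> R :=
  if s is i :: s' then partial i (iter_partial s' f) else f.

(* Meant for U open: all partial derivatives of order at most k exist and are
   continuous on U. The library's derivative is total, so the existence of each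
   derivative has to be required separately. *)
Definition Ck_on (k : nat) U f : Prop :=
  (forall s i, (size s < k)%N -> forall x, U x ->
     derivable (iter_partial s f) x (delta_mx 0 i)) /\
  (forall s, (size s <= k)%N -> forall x, U x ->
     {for x, continuous (iter_partial s f)}).

Definition smooth_on U f : Prop := forall k, Ck_on k U f.

End EuclideanCalculus.

Section Manifold.
Variables (R : realType) (n : nat) (M : topologicalType).

(* chart_coord and chart_param are total functions, meaningful only on
   chart_dom and chart_img, between which they are inverse homeomorphisms. *)
Record chart := Chart {
  chart_dom : set M ;
  chart_img : set 'rV[R]_n ;
  chart_coord : M -> 'rV[R]_n ;
  chart_param : 'rV[R]_n -> M ;
  chart_dom_open : open chart_dom ;
  chart_img_open : open chart_img ;
  chart_coord_img : forall p, chart_dom p -> chart_img (chart_coord p) ;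
  chart_param_dom : forall x, chart_img x -> chart_dom (chart_param x) ;
  chart_coordK : forall p, chart_dom p -> chart_param (chart_coord p) = p ;
  chart_paramK : forall x, chart_img x -> chart_coord (chart_param x) = x ;
  chart_coord_cont : forall p, chart_dom p -> {for p, continuous chart_coord} ;
  chart_param_cont : forall x, chart_img x -> {for x, continuous chart_param}
}.

Definition overlap (a b : chart) : set 'rV[R]_n :=
  chart_img a `&` chart_param a @^-1` chart_dom b.

Definition transition (a b : chart) : 'rV[R]_n -> 'rV[R]_n :=
  chart_coord b \o chart_param a.

Record smooth_atlas := SmoothAtlas {
  atlas_index : Type ;
  atlas_chart : atlas_index -> chart ;
  atlas_cover : forall p, exists i, chart_dom (atlas_chart i) p ;
  atlas_smooth : forall (i j : atlas_index) (l : 'I_n),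
    smooth_on (overlap (atlas_chart i) (atlas_chart j))
      (fun x => transition (atlas_chart i) (atlas_chart j) x 0 l)
}.

(* Second countability is not listed: it follows from compactness, since
   finitely many charts then cover M. Connectedness is not required. *)
Definition closed_manifold : Prop :=
  hausdorff_space M /\ compact [set: M].

(* Tangent vectors are rows, so row k of the matrix below is the derivative of
   the transition map along the k-th basis vector. *)
Definition transition_jacobian (a b : chart) (x : 'rV[R]_n) : 'M[R]_n :=
  \matrix_(k < n, l < n) partial k (fun y => transition a b y 0 l) x.

Definition metric_form (G : 'M[R]_n) (v : 'rV[R]_n) : R :=
  (v *m G *m v^T) 0 0.

Record riemannian_metric (A : smooth_atlas) := RiemannianMetric {
  metric_mx : atlas_index A -> 'rV[R]_n -> 'M[R]_n ;
  metric_smooth : forall i k l,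
    smooth_on (chart_img (atlas_chart i)) (fun x => metric_mx i x k l) ;
  metric_sym : forall i x, chart_img (atlas_chart i) x ->
    (metric_mx i x)^T = metric_mx i x ;
  metric_pos : forall i x, chart_img (atlas_chart i) x ->
    forall v, v != 0 -> 0 < metric_form (metric_mx i x) v ;
  metric_compat : forall i j x,
    overlap (atlas_chart i) (atlas_chart j) x ->
    let J := transition_jacobian (atlas_chart i) (atlas_chart j) x in
    metric_mx i x =
      J *m metric_mx j (transition (atlas_chart i) (atlas_chart j) x) *m J^T
}.

End Manifold.

Section LaplaceBeltrami.
Variables (R : realType) (n : nat).
Variable G : 'rV[R]_n -> 'M[R]_n.

Definition gradient (u : 'rV[R]_n -> R) (x : 'rV[R]_n) : 'rV[R]_n :=
  \row_(a < n) \sum_(b < n) invmx (G x) a b * partial b u x.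

Definition divergence (X : 'rV[R]_n -> 'rV[R]_n) (x : 'rV[R]_n) : R :=
  (Num.sqrt (\det (G x)))^-1 *
  \sum_(a < n) partial a (fun y => Num.sqrt (\det (G y)) * X y 0 a) x.

Definition laplacian (u : 'rV[R]_n -> R) : 'rV[R]_n -> R :=
  divergence (gradient u).

End LaplaceBeltrami.

Section RiemannianManifold.
Variables (R : realType) (n : nat) (M : topologicalType).
Variables (A : smooth_atlas R n M) (g : riemannian_metric A).

Definition local_rep (phi : M -> R) (i : atlas_index A) : 'rV[R]_n -> R :=
  phi \o chart_param (atlas_chart i).

(* Solutions are classical, i.e. C^2. *)
Definition eigenfunction (lambda : R) (phi : M -> R) : Prop :=
  [/\ exists p, phi p != 0,
      forall i, Ck_on 2 (chart_img (atlas_chart i)) (local_rep phi i)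
    & forall i x, chart_img (atlas_chart i) x ->
        laplacian (metric_mx g i) (local_rep phi i) x
          + lambda * local_rep phi i x = 0].

Definition nodal_domain (phi : M -> R) (Omega : set M) : Prop :=
  exists2 p, phi p != 0 &
    Omega = connected_component (~` (phi @^-1` [set 0])) p.

(* The part t in [0, 1] of c is a C^1 arc inside the i-th chart; asking c to be
   C^1 on the whole line loses nothing, as C^1 functions on [0, 1] extend. *)
Definition chart_arc (i : atlas_index A) (c : R -> 'rV[R]_n) : Prop :=
  [/\ forall t, derivable c t 1,
      continuous (fun t => 'D_1 c t)
    & forall t, 0 <= t <= 1 -> chart_img (atlas_chart i) (c t)].

Definition arc_length (i : atlas_index A) (c : R -> 'rV[R]_n) : \bar R :=
  (\int[lebesgue_measure]_(t in `[0%R, 1%R])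
     (Num.sqrt (metric_form (metric_mx g i (c t)) ('D_1 c t)))%:E)%E.

(* [curve_length p q L]: some piecewise C^1 curve from p to q has length L.
   Such a curve is a finite concatenation of C^1 arcs, each inside a chart. *)
Inductive curve_length : M -> M -> \bar R -> Prop :=
| curve_nil p : curve_length p p 0%E
| curve_cons i c q L :
    chart_arc i c ->
    curve_length (chart_param (atlas_chart i) (c 1)) q L ->
    curve_length (chart_param (atlas_chart i) (c 0)) q (arc_length i c + L)%E.

(* Equal to +oo when p and q lie in different connected components. *)
Definition riemannian_dist (p q : M) : \bar R :=
  ereal_inf [set L | curve_length p q L].

Definition geodesic_ball (p : M) (r : R) : set M :=
  [set q | (riemannian_dist p q < r%:E)%E].

Definition inrad (Omega : set M) : \bar R :=
  ereal_sup [set r%:E | r in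
    [set r : R | 0 < r /\ exists p, geodesic_ball p r `<=` Omega]].

End RiemannianManifold.

(* Main.v *)
(** Both bounds follow from the maximum principle, applied in charts to the
    non-divergence form tr(a D^2 u) + b . D u = - lambda u of the equation.

    Upper bound (Barta): if u had no zero in a coordinate ball of radius
    rho = K / sqrt lambda, the quotient of the bump (rho^2 - |x - p|^2)^2 by |u| would
    have an interior maximum, and the second derivative test there is violated once K
    is large. So every geodesic ball of radius C2 / sqrt lambda contains a zero.

    Lower bound: take the nodal domain of a point p where |phi| attains its maximum m.
    Comparing u x - u y on a ball of radius 1 / sqrt lambda with
    m (2 lambda (|x - p|^2 + |y - p|^2) + L (sqrt lambda |x - y|)^(1/2))
    as a function of the pair (x, y) (doubling of variables, after Ishii and Lions)
    bounds the oscillation of u near p, so phi keeps its sign on a ball of radius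
    C1 / sqrt lambda. This only needs u of class C^2: no elliptic regularity enters.

    Compactness of M makes the thresholds on lambda uniform; the constants C1 and C2
    come out depending on n only. *)
From HB Require Import structures.
Require Import Defs.
From mathcomp Require Import all_boot all_order all_algebra.
From mathcomp Require Import all_classical all_reals all_analysis.
From mathcomp Require Import ring lra.

Import Order.TTheory GRing.Theory Num.Theory.
Import numFieldNormedType.Exports.

Local Open Scope classical_set_scope.
Local Open Scope ring_scope.

Set Implicit Arguments.
Unset Strict Implicit.
Unset Printing Implicit Defensive.

(** * Positive definite forms *)

Section PositiveDefinite.
Context {R : realType}.

(** The obstacle in the doubling is that the leading coefficients differ at the two points, while a
    pairing of second derivatives at [x] and [y] wants one matrix for both. Near a frozen point they
    are split as [kappa A0 + E x] with [kappa < 1]. The common part is tested along paired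
    directions. The remainder is positive definite thanks to the deficit [1 - kappa], hence a sum of
    squares that can be tested at each point alone, and its trace is at most [1/8]. The square root
    of the distance serves through its strict concavity: at squared distance [s] its radial second
    derivative has order [s^(-3/4)], the order of the losses due to [E], while the drift loses no
    more than that order on the unit ball. The outcome is thus decided by numerical constants: the
    losses carry small factors, and a large [L] absorbs the terms without [s^(-3/4)]. *)

Definition posdef n (G : 'M[R]_n) : Prop :=
  G^T = G /\ forall v, v != 0 -> 0 < metric_form G v.

Definition bform n (G : 'M[R]_n) (u v : 'rV[R]_n) : R := (u *m G *m v^T) 0 0.

Lemma metric_formE n (G : 'M[R]_n) v : metric_form G v = bform G v v.
Proof. by []. Qed.

Lemma bformDl n (G : 'M[R]_n) u v w : bform G (u + v) w = bform G u w + bform G v w.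
Proof. by rewrite /bform !mulmxDl mxE. Qed.

Lemma bformDr n (G : 'M[R]_n) u v w : bform G u (v + w) = bform G u v + bform G u w.
Proof. by rewrite /bform linearD /= mulmxDr mxE. Qed.

Lemma bformZl n (G : 'M[R]_n) a u v : bform G (a *: u) v = a * bform G u v.
Proof. by rewrite /bform -!scalemxAl mxE. Qed.

Lemma bformZr n (G : 'M[R]_n) a u v : bform G u (a *: v) = a * bform G u v.
Proof. by rewrite /bform linearZ /= -scalemxAr mxE. Qed.

Lemma bformC n (G : 'M[R]_n) u v : G^T = G -> bform G u v = bform G v u.
Proof.
move=> Gs; rewrite /bform.
have -> : u *m G *m v^T = (v *m G *m u^T)^T by rewrite !trmx_mul trmxK Gs mulmxA.
by rewrite mxE.
Qed.

Lemma bformDm n (G1 G2 : 'M[R]_n) u v : bform (G1 + G2) u v = bform G1 u v + bform G2 u v.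
Proof. by rewrite /bform mulmxDr mulmxDl mxE. Qed.

Lemma bformZm n (G : 'M[R]_n) a u v : bform (a *: G) u v = a * bform G u v.
Proof. by rewrite /bform -scalemxAr -scalemxAl mxE. Qed.

Lemma metric_formD n (G : 'M[R]_n) u v : G^T = G ->
  metric_form G (u + v) = metric_form G u + 2 * bform G u v + metric_form G v.
Proof.
by move=> Gs; rewrite !metric_formE !bformDl !bformDr (bformC v u)//; ring.
Qed.

Lemma metric_formZ n (G : 'M[R]_n) a v : metric_form G (a *: v) = a ^+ 2 * metric_form G v.
Proof. by rewrite !metric_formE bformZl bformZr; ring. Qed.

Lemma metric_form0 n (G : 'M[R]_n) : metric_form G 0 = 0.
Proof. by rewrite /metric_form !mul0mx mxE. Qed.

Lemma metric_formN n (G : 'M[R]_n) v : metric_form G (- v) = metric_form G v.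
Proof. by rewrite -scaleN1r metric_formZ sqrrN expr1n mul1r. Qed.

Lemma bformr0 n (G : 'M[R]_n) u : bform G u 0 = 0.
Proof. by rewrite /bform trmx0 mulmx0 mxE. Qed.

Lemma bformNr n (G : 'M[R]_n) u v : bform G u (- v) = - bform G u v.
Proof. by rewrite -scaleN1r bformZr mulN1r. Qed.

Lemma metric_formB n (G : 'M[R]_n) u v : G^T = G ->
  metric_form G (u - v) = metric_form G u - 2 * bform G u v + metric_form G v.
Proof. by move=> Gs; rewrite metric_formD// bformNr metric_formN mulrN. Qed.

Lemma posdef_ge0 n (G : 'M[R]_n) v : posdef G -> 0 <= metric_form G v.
Proof.
move=> [_ Gp]; have [->|/Gp/ltW//] := eqVneq v 0; by rewrite metric_form0.
Qed.

Lemma posdefZ n (G : 'M[R]_n) c : 0 < c -> posdef G -> posdef (c *: G).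
Proof.
move=> c0 [Gs Gp]; split; first by rewrite linearZ /= Gs.
by move=> v v0; rewrite metric_formE bformZm mulr_gt0 ?Gp.
Qed.

(* Induction on the dimension through the Schur complement. *)
Lemma cholesky n (G : 'M[R]_n) : posdef G -> exists V : 'M[R]_n, G = V^T *m V.
Proof.
elim: n G => [|n IH]; first by exists 0; apply/matrixP => -[].
rewrite -[n.+1]/(1 + n)%N => G [].
rewrite -(@submxK _ 1 n 1 n G).
move: (ulsubmx G) (ursubmx G) (dlsubmx G) (drsubmx G) => {G} a b c d.
rewrite tr_block_mx => /eq_block_mx[_ cb _ ds] Gp.
have cE : c = b^T by rewrite -cb trmxK.
have form x w : metric_form (block_mx a b c d) (row_mx x%:M w) =
    a 0 0 * x ^+ 2 + 2 * x * (b *m w^T) 0 0 + metric_form d w.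
  rewrite /metric_form mul_row_block tr_row_mx mul_row_col !mulmxDl.
  rewrite tr_scalar_mx !mul_scalar_mx !mul_mx_scalar -!scalemxAl.
  rewrite cE (_ : w *m b^T = (b *m w^T)^T); last by rewrite trmx_mul trmxK.
  move: (b *m w^T) (w *m d *m w^T) => X Y.
  by rewrite !mxE; ring.
have a0 : 0 < a 0 0.
  have : 0 < metric_form (block_mx a b c d) (row_mx 1%:M 0).
    apply: Gp; apply/eqP => /(congr1 (fun M : 'rV_(1 + n) => M 0 (lshift n 0))).
    by rewrite row_mxEl !mxE eqxx => /eqP; rewrite oner_eq0.
  by rewrite form metric_form0 trmx0 mulmx0 [X in _ + _ * X]mxE mulr0 !addr0 expr1n mulr1.
pose S := d - (a 0 0)^-1 *: (b^T *m b).
have [|W WE] := IH S.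
  split; first by rewrite /S linearB /= linearZ /= trmx_mul trmxK ds.
  move=> w w0; pose x := - (a 0 0)^-1 * (b *m w^T) 0 0.
  have : 0 < metric_form (block_mx a b c d) (row_mx x%:M w).
    apply: Gp; apply: contra_neq w0 => /eqP.
    by rewrite -(@row_mx0 _ 1 1 n) => /eqP/eq_row_mx[].
  rewrite form.
  have -> : metric_form S w = metric_form d w - (a 0 0)^-1 * (b *m w^T) 0 0 ^+ 2.
    rewrite /metric_form /S mulmxBr mulmxBl -scalemxAr -scalemxAl.
    rewrite (_ : w *m (b^T *m b) *m w^T = (b *m w^T)^T *m (b *m w^T)); last first.
      by rewrite trmx_mul trmxK !mulmxA.
    move: (b *m w^T) (w *m d *m w^T) => X Y.
    by rewrite !mxE big_ord1 !mxE expr2.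
  have -> : a 0 0 * x ^+ 2 + 2 * x * (b *m w^T) 0 0 =
      - ((a 0 0)^-1 * (b *m w^T) 0 0 ^+ 2) by rewrite /x; field; rewrite gt_eqF.
  by rewrite addrC.
pose s := Num.sqrt (a 0 0).
have s0 : s != 0 by rewrite gt_eqF// sqrtr_gt0.
have sE : s * s = a 0 0 by rewrite -expr2 sqr_sqrtr// ltW.
exists (block_mx s%:M (s^-1 *: b) 0 W).
rewrite tr_block_mx mulmx_block !linearZ /= trmx0 !mul0mx !mulmx0 !addr0.
rewrite tr_scalar_mx -!scalar_mxM sE -WE /S.
congr block_mx.
- by rewrite [LHS]mx11_scalar.
- by rewrite mul_scalar_mx scalerA mulVf// scale1r.
- by rewrite -scalemxAl mul_mx_scalar scalerA mulVf// scale1r cE.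
- by rewrite -scalemxAl scalerA -invfM sE addrC subrK.
Qed.

Lemma posdef_unit n (G : 'M[R]_n) : posdef G -> G \in unitmx.
Proof.
move=> [_ Gp]; rewrite -row_free_unit -kermx_eq0; apply/negPn/negP.
move/rowV0Pn => [v /sub_kermxP vG /Gp]; by rewrite /metric_form vG mul0mx mxE ltxx.
Qed.

Lemma posdef_det n (G : 'M[R]_n) : posdef G -> 0 < \det G.
Proof.
move=> pG; have := posdef_unit pG; rewrite unitmxE unitfE => d0.
rewrite lt0r d0 /=; have [V ->] := cholesky pG.
by rewrite det_mulmx det_tr -expr2 sqr_ge0.
Qed.

Lemma posdef_inv n (G : 'M[R]_n) : posdef G -> posdef (invmx G).
Proof.
move=> pG; have uG := posdef_unit pG; case: pG => Gs Gp.
have As : (invmx G)^T = invmx G by rewrite trmx_inv Gs.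
split=> // v v0; have := Gp (v *m invmx G).
rewrite /metric_form trmx_mul As !mulmxA mulmxKV //.
apply; apply: contra_neq v0 => v0; by rewrite -(mulmxKV uG v) v0 mul0mx.
Qed.

Lemma cauchy_schwarz n (G : 'M[R]_n) u v : posdef G ->
  bform G u v ^+ 2 <= metric_form G u * metric_form G v.
Proof.
move=> pG; have [->|v0] := eqVneq v 0.
  by rewrite metric_form0 mulr0 /bform trmx0 mulmx0 mxE expr0n.
have qv : 0 < metric_form G v by case: pG => _; apply.
have := posdef_ge0 (metric_form G v *: u - bform G u v *: v) pG.
rewrite metric_formD; last by case: pG.
rewrite metric_formN !metric_formZ -scaleN1r bformZl !bformZr.
nra.
Qed.

(** Cauchy-Schwarz against row [i] of [invmx G], the vector that represents the [i]-th coordinate in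
    the inner product of [G]. *)
Lemma coord_le_form n (G : 'M[R]_n) (v : 'rV[R]_n) (i : 'I_n) : posdef G ->
  v 0 i ^+ 2 <= metric_form G v * invmx G i i.
Proof.
move=> pG; have uG := posdef_unit pG.
have As : (invmx G)^T = invmx G by case: (posdef_inv pG).
have := cauchy_schwarz v (delta_mx 0 i *m invmx G) pG.
have -> : bform G v (delta_mx 0 i *m invmx G) = v 0 i.
  by rewrite /bform trmx_mul As mulmxA mulmxK// trmx_delta -colE mxE.
suff -> : metric_form G (delta_mx 0 i *m invmx G) = invmx G i i by [].
by rewrite /metric_form trmx_mul As mulmxKV// mulmxA -rowE trmx_delta -colE !mxE.
Qed.

Lemma posdef_inv_diag n (G : 'M[R]_n) : posdef G -> forall i, 0 <= invmx G i i.
Proof.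
move=> pG i; have /posdef_ge0 := posdef_inv pG => /(_ (delta_mx 0 i)).
by rewrite /metric_form -rowE trmx_delta -colE !mxE.
Qed.

Lemma metric_form_sum n (S : 'M[R]_n) (v : 'rV[R]_n) :
  metric_form S v = \sum_j \sum_i v 0 i * S i j * v 0 j.
Proof.
rewrite /metric_form mxE; apply: eq_bigr => j _.
by rewrite !mxE mulr_suml.
Qed.

(** With [H] a Hessian and [V] a Cholesky factor, this turns the second-order part of the equation
    into second derivatives along lines, to which one-variable tests apply. *)
Lemma mxtrace_gram n (V H : 'M[R]_n) :
  \sum_k metric_form H (row k V) = \tr (V^T *m V *m H).
Proof.
rewrite -mulmxA mxtrace_mulC /mxtrace; apply: eq_bigr => k _.
rewrite /metric_form -row_mul !mxE; apply: eq_bigr => j _.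
by rewrite !mxE.
Qed.

Lemma posdef_perturb n (A : 'M[R]_n) : posdef A ->
  exists2 e, 0 < e & forall S : 'M[R]_n, S^T = S ->
    (forall i j, `|S i j| <= e) -> posdef (A + S).
Proof.
move=> pA; pose al := \sum_i invmx A i i.
have ige0 := posdef_inv_diag pA.
have al0 : 0 <= al by apply: sumr_ge0.
(* By [coord_le_form] every [v_i^2] is at most [q * al], so [S] contributes at most [n^2 e q al],
   and this [e] makes that at most [q / 2]. *)
pose e := (2 * (al + 1) * (n%:R ^+ 2 + 1))^-1.
have n0 : 0 <= n%:R ^+ 2 :> R by rewrite exprn_ge0.
have den0 : 0 < 2 * (al + 1) * (n%:R ^+ 2 + 1) :> R by nra.
exists e; first by rewrite invr_gt0.
move=> S Ss Se; split; first by case: pA => As _; rewrite linearD /= As Ss.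
move=> v v0; have qv : 0 < metric_form A v by case: pA => _; apply.
set q := metric_form A v in qv.
have vle i : `|v 0 i| ^+ 2 <= q * al.
  rewrite -normrX ger0_norm ?sqr_ge0//; apply: (le_trans (coord_le_form v i pA)).
  by rewrite ler_wpM2l ?(ltW qv)// /al (bigD1 i)//= lerDl sumr_ge0.
have vv i j : `|v 0 i| * `|v 0 j| <= q * al.
  by have := vle i; have := vle j; have := sqr_ge0 (`|v 0 i| - `|v 0 j|); nra.
have : `|metric_form S v| <= n%:R ^+ 2 * (e * (q * al)).
  rewrite metric_form_sum (le_trans (ler_norm_sum _ _ _))//.
  rewrite (_ : n%:R ^+ 2 * _ = \sum_(j < n) \sum_(i < n) e * (q * al)); last first.
    by rewrite !sumr_const !card_ord -mulrnA -[RHS]mulr_natl natrM expr2.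
  apply: ler_sum => j _; rewrite (le_trans (ler_norm_sum _ _ _))//.
  apply: ler_sum => i _; rewrite !normrM.
  rewrite mulrAC mulrC ler_pM// ?mulr_ge0//.
rewrite (metric_formE (A + S)) bformDm -!metric_formE -/q ler_norml => /andP[h _].
have eE : e * (2 * (al + 1) * (n%:R ^+ 2 + 1)) = 1 by rewrite mulVf// gt_eqF.
have e0 : 0 < e by rewrite invr_gt0.
have : n%:R ^+ 2 * (e * (q * al)) <= q / 2.
  have -> : q / 2 = (q / 2) * (e * (2 * (al + 1) * (n%:R ^+ 2 + 1))).
    by rewrite eE mulr1.
  rewrite (_ : n%:R ^+ 2 * (e * (q * al)) = (q * e) * (n%:R ^+ 2 * al)); last by ring.
  rewrite (_ : q / 2 * _ = (q * e) * ((al + 1) * (n%:R ^+ 2 + 1))); last by field.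
  by rewrite ler_wpM2l// ?mulr_ge0 ?ltW//; nra.
lra.
Qed.

End PositiveDefinite.

(** * Derivatives along lines and curves *)

Section Calculus.
Context {R : realType}.

Lemma for_continuous_sum (I : finType) (T : topologicalType) (f : I -> T -> R) x :
  (forall i, {for x, continuous (f i)}) ->
  {for x, continuous (fun y => \sum_i f i y)}.
Proof.
move=> cf; rewrite /continuous_at.
exact: (@cvg_big R I +%R 0 xpredT (@add_continuous R) T (nbhs x) _ f (f ^~ x) _ (fun i _ => cf i)).
Qed.

Lemma coord_le_norm n (v : 'rV[R]_n) (i : 'I_n) : `|v 0 i| <= `|v|.
Proof.
rewrite [leRHS]/Num.Def.normr/= mx_normrE.
exact: (le_bigmax _ (fun ij : 'I_1 * 'I_n => `|v ij.1 ij.2|) (0, i)).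
Qed.

Lemma norm_le_coord n (v : 'rV[R]_n) e : 0 <= e ->
  (forall i : 'I_n, `|v 0 i| <= e) -> `|v| <= e.
Proof.
move=> e0 ve; rewrite /Num.Def.normr/= mx_normrE (bigmax_le _ e0)//= => -[i j] _.
by rewrite ord1; exact: ve.
Qed.

Lemma is_derive_line n (f : 'rV[R]_n -> R) a v t0 d :
  is_derive (a + t0 *: v) v f d <-> is_derive t0 1 (fun t => f (a + t *: v)) d.
Proof.
suff E : (fun h => h^-1 *: ((f \o shift (a + t0 *: v)) (h *: v) - f (a + t0 *: v)))
   = (fun h => h^-1 *: (((fun t => f (a + t *: v)) \o shift t0) (h *: (1:R)) - f (a + t0 *: v))).
  by split=> -[h1 h2]; split; [move: h1|rewrite -h2|move: h1|rewrite -h2];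
    rewrite /derivable /derive E.
apply/funext => h /=; rewrite (_ : h *: v + _ = a + (h%:A + t0) *: v)//.
by rewrite [_%:A]mulr1 scalerDl addrCA.
Qed.

(** The endpoints are unordered because it is applied to the coordinates of a displacement, which
    have either sign. *)
Lemma mvt_bound (g dg : R -> R) (a b c e : R) :
  (forall t, Num.min a b <= t <= Num.max a b ->
    is_derive t 1 g (dg t) /\ `|dg t - c| <= e) ->
  `|g b - g a - c * (b - a)| <= e * `|b - a|.
Proof.
wlog ab : a b / a <= b => [H|].
  case/orP: (le_total a b) => [/H//|ba gab].
  rewrite -normrN (_ : - (g b - g a - c * (b - a)) = g a - g b - c * (a - b)); last by ring.
  rewrite (distrC b); apply: H => // t; rewrite minC maxC; exact: gab.
rewrite (min_idPl ab) (max_idPr ab) => gab.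
have [||t tab ->] := @MVT_segment R g dg a b ab.
- by move=> t; rewrite in_itv/= => /andP[/ltW ta /ltW tb]; apply gab; rewrite ta tb.
- apply: derivable_within_continuous => t; rewrite in_itv/= => /gab[[]].
  by [].
rewrite -mulrBl normrM ler_wpM2r//.
by move: tab; rewrite in_itv => /gab[].
Qed.

Definition gradient_form n (f : 'rV[R]_n -> R) (x v : 'rV[R]_n) : R :=
  \sum_(i < n) v 0 i * partial i f x.

Lemma gradient_form_linear n (f : 'rV[R]_n -> R) x : linear (gradient_form f x : _ -> R^o).
Proof.
move=> a u v; rewrite /gradient_form /GRing.scale/= mulr_sumr -big_split/=.
by apply: eq_bigr => i _; rewrite !mxE mulrDl mulrA.
Qed.

Lemma gradient_form_continuous n (f : 'rV[R]_n -> R) x : continuous (gradient_form f x).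
Proof.
move=> v; rewrite /gradient_form; apply: for_continuous_sum => i.
by apply: continuousM; [exact: coord_continuous|exact: cst_continuous].
Qed.

(* The increment is telescoped along a path parallel to the coordinate axes. *)
Lemma C1_expansion n (U : set 'rV[R]_n) f x (e : R) : open U -> Ck_on 1 U f -> U x -> 0 < e ->
  \forall h \near (0 : 'rV[R]_n), `|f (x + h) - f x - gradient_form f x h| <= e * `|h|.
Proof.
move=> oU [df cf] Ux e0; pose e' := e / (n%:R + 1).
have n0 : 0 < n%:R + 1 :> R by rewrite ltr_wpDl.
have e'0 : 0 < e' by rewrite divr_gt0.
have xU : \forall y \near x, U y by exact: open_nbhs_nbhs.
have xp : \forall y \near x, forall i : 'I_n, `|partial i f y - partial i f x| <= e'.
  apply: (@filter_forall _ _ _ (nbhs x)) => i.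
  have /cvgrPdist_le := cf [:: i] isT x Ux.
  by move=> /(_ _ e'0); apply: filterS => y; rewrite distrC.
have /nbhs_ballP[d /= d0 dU] : nbhs x (U `&` [set y | forall i, `|partial i f y - partial i f x| <= e']).
  exact: filterI.
apply/nbhs_ballP; exists d => // h /=.
rewrite -ball_normE /= sub0r normrN => hd.
(* The norm is the maximum norm, so all segments of this path stay within distance [|h|] of [x]. *)
pose p k : 'rV[R]_n := \row_i (if (i < k)%N then h 0 i else 0).
have p0 : p 0 = 0 by apply/rowP => i; rewrite !mxE.
have pn : p n = h by apply/rowP => i; rewrite !mxE ltn_ord.
have pS (k : 'I_n) : p k.+1 = p k + h 0 k *: delta_mx 0 k.
  apply/rowP => i; rewrite !mxE eqxx/= ltnS leq_eqVlt -val_eqE/=.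
  have [ik|ik] := eqVneq (i : nat) k; last by rewrite mulr0 addr0.
  by rewrite ik ltnn add0r mulr1; congr (h 0 _); exact: val_inj.
have -> : f (x + h) - f x - gradient_form f x h =
   \sum_(k < n) (f (x + p k.+1) - f (x + p k) - partial k f x * (h 0 k - 0)).
  rewrite sumrB -(big_mkord xpredT (fun k => f (x + p k.+1) - f (x + p k))).
  rewrite (telescope_sumr (fun k => f (x + p k)))// p0 pn addr0; congr (_ - _).
  by apply: eq_bigr => i _; rewrite subr0 mulrC.
apply: (le_trans (ler_norm_sum _ _ _)).
apply: (@le_trans _ _ (\sum_(k < n) e' * `|h|)).
  apply: ler_sum => k _; rewrite pS addrA -[X in _ - f X]addr0 -(scale0r (delta_mx 0 k)).
  apply: (@le_trans _ _ (e' * `|h 0 k - 0|)); last first.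
    by rewrite subr0 ler_wpM2l ?(ltW e'0)// coord_le_norm.
  apply: (@mvt_bound (fun t => f (x + p k + t *: delta_mx 0 k))
    (fun t => partial k f (x + p k + t *: delta_mx 0 k))) => t th.
  have [|Ut /(_ k) pt] := dU (x + p k + t *: delta_mx 0 k).
    rewrite -ball_normE /=.
    rewrite (_ : x - _ = - (p k + t *: delta_mx 0 k)); last first.
      by rewrite -addrA opprD addrA subrr add0r.
    rewrite normrN; apply: le_lt_trans hd; apply: norm_le_coord => // i.
    rewrite !mxE eqxx /=; have [ik|ik] := eqVneq i k.
      rewrite ik ltnn add0r mulr1; apply: le_trans (coord_le_norm h k).
      move: th; case: (leP 0 (h 0 k)) => hk /andP[t1 t2].
        by rewrite !ger0_norm.
      by rewrite !ler0_norm ?lerN2// ltW.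
    rewrite mulr0 addr0; case: ifP => _; last by rewrite normr0.
    exact: coord_le_norm.
  split => //; apply/is_derive_line; apply: derivableP.
  exact: (df [::] k).
rewrite sumr_const card_ord -mulr_natl mulrA ler_wpM2r//.
by rewrite /e' mulrA ler_pdivrMr// mulrC ler_wpM2l ?(ltW e0)// lerDl.
Qed.

Lemma C1_differentiable n (U : set 'rV[R]_n) f x : open U -> Ck_on 1 U f -> U x ->
  is_diff x f (gradient_form f x).
Proof.
move=> oU Cf Ux.
pose L : {linear 'rV[R]_n -> R} :=
  HB.pack (gradient_form f x : 'rV[R]_n -> R)
    (GRing.isLinear.Build R 'rV[R]_n R *:%R _ (gradient_form_linear f x)).
have fL (e : R) : 0 < e -> \forall h \near (0 : 'rV[R]_n),
    `|(f \o shift x - (cst (f x) + L)) h| <= e * `|h|.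
  move=> e0; have := C1_expansion oU Cf Ux e0; apply: filterS => h.
  by rewrite !fctE /= opprD addrA [h + x]addrC.
have dL : 'd f x = L :> (_ -> _).
  apply: diff_unique; first exact: gradient_form_continuous.
  by apply/eqaddoP => e; exact: fL.
apply: DiffDef => //; apply/diff_locallyP; rewrite dL; split.
  exact: gradient_form_continuous.
by apply/eqaddoP => e; exact: fL.
Qed.

Lemma C1_derive n (U : set 'rV[R]_n) f x v : open U -> Ck_on 1 U f -> U x ->
  is_derive x v f (gradient_form f x v).
Proof.
move=> oU Cf Ux; have [dfx dfE] := C1_differentiable oU Cf Ux.
by split; [exact: diff_derivable|rewrite deriveE// dfE].
Qed.

End Calculus.

(** * First and second derivative tests along lines *)

Section DerivativeTests.
Context {R : realType}.

Lemma is_derive_expansion (f : R -> R) (x d e : R) : is_derive x 1 f d -> 0 < e ->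
  exists2 r : R, 0 < r & forall h, `|h| < r -> `|f (x + h) - f x - d * h| <= e * `|h|.
Proof.
move=> [dfx dfE] e0.
have : h^-1 *: ((f \o shift x) (h *: (1 : R)) - f x) @[h --> 0^'] --> d by rewrite -dfE.
move/cvgrPdist_le => /(_ _ e0) [r /= r0 rP]; exists r => // h hr.
have [->|h0] := eqVneq h 0; first by rewrite addr0 mulr0 !subrr normr0 mulr0.
have := rP h; rewrite /= sub0r normrN => /(_ hr h0).
rewrite [_%:A]mulr1 /GRing.scale/= [h + x]addrC => H.
rewrite -(ler_pM2r (_ : 0 < `|h|^-1)) ?invr_gt0 ?normr_gt0//.
rewrite mulfK ?normr_eq0// -normfV -normrM distrC in H *.
apply: le_trans H; rewrite le_eqVlt; apply/orP; left; apply/eqP; congr `|_|.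
by field.
Qed.

Lemma first_order_test (g : R -> R) (d c C : R) : is_derive (0 : R) 1 g d ->
  (\forall t \near (0 : R), 0 < t -> g t - g 0 <= c * t + C * t ^+ 2) -> d <= c.
Proof.
move=> dg [r1 /= r10 gle]; rewrite leNgt; apply/negP => cd.
have [|r2 r20 gexp] := @is_derive_expansion g 0 d ((d - c) / 4) dg; first by lra.
(* At this [t] the quadratic term and the expansion error each take at most a quarter of the gap
   [(d - c) * t], a contradiction. *)
pose t := Num.min (Num.min (r1 / 2) (r2 / 2)) ((d - c) / 4 / (`|C| + 1)).
have C0 : 0 <= `|C| by [].
have t0 : 0 < t by rewrite !lt_min !divr_gt0//; lra.
have tr1 : t < r1 by apply: (@le_lt_trans _ _ (r1 / 2)); rewrite ?ge_min ?lexx//; lra.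
have tr2 : t < r2.
  by apply: (@le_lt_trans _ _ (r2 / 2)); rewrite ?ge_min ?lexx ?orbT//; lra.
have tC : t * (`|C| + 1) <= (d - c) / 4.
  by rewrite -ler_pdivlMr ?ge_min ?lexx ?orbT//; lra.
have := gexp t; rewrite gtr0_norm// add0r => /(_ tr2); rewrite ler_norml => /andP[h _].
have := gle t; rewrite /= sub0r normrN gtr0_norm// => /(_ tr1 t0).
have := ler_norm C.
nra.
Qed.

(** The mean value theorem for [g s + g (- s) - c s^2] replaces a Taylor expansion: its derivative
    is at least [2 (k - c) s - (k - c) s > 0] for small [s > 0], by differentiability of [dg] at [0]
    alone. *)
Lemma second_order_test (g dg : R -> R) (k c : R) :
  (\forall t \near (0 : R), is_derive (t : R) 1 g (dg t)) -> is_derive (0 : R) 1 dg k ->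
  (\forall t \near (0 : R), g t + g (- t) - 2 * g 0 <= c * t ^+ 2) -> k <= c.
Proof.
move=> [r1 /= r10 gdg] ddg [r2 /= r20 gle]; rewrite leNgt; apply/negP => ck.
have [|r3 r30 dgexp] := @is_derive_expansion dg 0 k ((k - c) / 2) ddg; first by lra.
pose t := Num.min (r1 / 2) (Num.min (r2 / 2) (r3 / 2)).
have t0 : 0 < t by rewrite !lt_min !divr_gt0.
have tr1 : t < r1 by apply: (@le_lt_trans _ _ (r1 / 2)); rewrite ?ge_min ?lexx//; lra.
have tr2 : t < r2.
  by apply: (@le_lt_trans _ _ (r2 / 2)); rewrite ?ge_min ?lexx ?orbT//; lra.
have tr3 : t < r3.
  by apply: (@le_lt_trans _ _ (r3 / 2)); rewrite ?ge_min ?lexx ?orbT//; lra.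
pose f s := g s + g (- s) - c * s ^+ 2.
pose df s := dg s - dg (- s) - c * (2 * s).
have fdf s : 0 <= s <= t -> is_derive s 1 f (df s).
  move=> /andP[s0 st].
  have d1 : is_derive s 1 g (dg s).
    by apply: gdg; rewrite /= sub0r normrN ger0_norm//; lra.
  have d2 : is_derive (- s) 1 g (dg (- s)).
    by apply: gdg; rewrite /= sub0r opprK ger0_norm//; lra.
  have d3 : is_derive s 1 (g \o -%R) (dg (- s) * -1).
    exact: is_derive1_comp.
  have d4 : is_derive s 1 (fun s : R => s ^+ 2) (2 * s).
    have := @is_deriveX _ _ (@id R) 2 s 1 1 (is_derive_id _ _).
    by rewrite /= expr1 [_%:A]mulr1.
  have -> : f = (g + (g \o -%R)) - c *: (fun s : R => s ^+ 2) by [].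
  have -> : df s = (dg s + dg (- s) * -1) - c *: (2 * s).
    by rewrite /df mulrN1.
  by apply: is_deriveB.
have [||s] := @MVT R f df 0 t t0.
- by move=> s; rewrite in_itv/= => /andP[s0 st]; apply: fdf; rewrite !ltW.
- apply: derivable_within_continuous => s; rewrite in_itv/= => /fdf[].
  by [].
rewrite in_itv/= => /andP[s0 st] fE.
have := dgexp s; rewrite gtr0_norm// add0r => /(_ (lt_trans st tr3)).
rewrite ler_norml => /andP[h1 _].
have := dgexp (- s); rewrite normrN gtr0_norm// add0r => /(_ (lt_trans st tr3)).
rewrite ler_norml => /andP[_ h2].
have := gle t; rewrite /= sub0r normrN gtr0_norm// => /(_ tr2).
move: fE; rewrite /f /df oppr0 expr0n mulr0 => fE h3.
have : 0 < (dg s - dg (- s) - c * (2 * s)) * t by apply: mulr_gt0 => //; nra.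
rewrite subr0 in fE.
lra.
Qed.

Lemma iter_partial_rcons n s i (f : 'rV[R]_n -> R) :
  iter_partial (rcons s i) f = iter_partial s (partial i f).
Proof. by elim: s => //= j s ->. Qed.

Lemma Ck_onW n k l (U : set 'rV[R]_n) f : (k <= l)%N -> Ck_on l U f -> Ck_on k U f.
Proof.
move=> kl [df cf]; split=> [s i sk|s sk]; [apply: df|apply: cf].
  exact: leq_trans sk kl.
exact: leq_trans sk kl.
Qed.

Lemma Ck_on_partial n k (U : set 'rV[R]_n) f i : Ck_on k.+1 U f -> Ck_on k U (partial i f).
Proof.
move=> [df cf]; split=> [s j sk x Ux|s sk x Ux]; rewrite -iter_partial_rcons.
  by apply: df => //; rewrite size_rcons.
by apply: cf => //; rewrite size_rcons.
Qed.

Definition hess n (u : 'rV[R]_n -> R) (x : 'rV[R]_n) : 'M[R]_n :=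
  \matrix_(i, j) partial i (partial j u) x.

Lemma line_continuous n (x v : 'rV[R]_n) : continuous (fun t : R => x + t *: v).
Proof.
move=> t; apply: cvgD; first exact: cvg_cst.
exact: scalel_continuous.
Qed.

Lemma near_line n (x v : 'rV[R]_n) (P : set 'rV[R]_n) :
  (\forall y \near x, P y) -> \forall t \near (0 : R), P (x + t *: v).
Proof.
move=> xP; have := @line_continuous n x v 0; apply.
by rewrite scale0r addr0.
Qed.

Section C2Line.
Variables (n : nat) (U : set 'rV[R]_n) (u : 'rV[R]_n -> R) (x v : 'rV[R]_n).
Hypotheses (oU : open U) (Cu : Ck_on 2 U u) (Ux : U x).

Lemma C2_line : \forall t \near (0 : R),
  is_derive (t : R) 1 (fun t => u (x + t *: v)) (gradient_form u (x + t *: v) v).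
Proof.
have : \forall t \near (0 : R), U (x + t *: v).
  by apply: near_line; exact: open_nbhs_nbhs.
apply: filterS => t Ut; apply/is_derive_line; apply: (C1_derive v oU _ Ut).
exact: Ck_onW Cu.
Qed.

Lemma C2_line_second :
  is_derive (0 : R) 1 (fun t => gradient_form u (x + t *: v) v) (metric_form (hess u x) v).
Proof.
have -> : metric_form (hess u x) v =
    \sum_(j < n) v 0 j * gradient_form (partial j u) x v.
  rewrite metric_form_sum; apply: eq_bigr => j _; rewrite mulr_sumr.
  by apply: eq_bigr => i _; rewrite mxE; ring.
have -> : (fun t => gradient_form u (x + t *: v) v) =
    \sum_(j < n) v 0 j *: (fun t => partial j u (x + t *: v)).
  by apply/funext => t; rewrite /gradient_form fct_sumE.
apply: is_derive_sum => j; apply: is_deriveZ; apply/is_derive_line.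
rewrite scale0r addr0; apply: (C1_derive v oU _ Ux).
exact: Ck_on_partial.
Qed.

Lemma C2_line0 : is_derive (0 : R) 1 (fun t => u (x + t *: v)) (gradient_form u x v).
Proof. by have := nbhs_singleton C2_line; rewrite scale0r addr0. Qed.

End C2Line.

End DerivativeTests.

(** * Functions of class C^1 and the non-divergence form of the Laplacian *)

Section C1Functions.
Context {R : realType}.

Section Closure.
Variables (n : nat) (U : set 'rV[R]_n).
Hypothesis oU : open U.
Implicit Types f g : 'rV[R]_n -> R.

Lemma is_derive_comp1 (h : R -> R) f x v a b :
  is_derive (f x) 1 h a -> is_derive x v f b -> is_derive x v (h \o f) (a * b).
Proof.
move=> dh df; have x0 : x = x + 0 *: v by rewrite scale0r addr0.
rewrite x0; apply/is_derive_line; rewrite {1}x0 in df.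
apply: (@is_derive1_comp _ h (fun t => f (x + t *: v))); last exact/is_derive_line.
by rewrite -x0.
Qed.

Lemma continuous_near_eq (T : topologicalType) (f g : T -> R) x :
  (\forall y \near x, f y = g y) -> {for x, continuous f} -> {for x, continuous g}.
Proof.
move=> fg cf; rewrite /prop_for /continuous_at -(nbhs_singleton fg).
exact: cvg_trans (near_eq_cvg fg) cf.
Qed.

Lemma Ck1_intro f (df : 'I_n -> 'rV[R]_n -> R) :
  (forall x, U x -> {for x, continuous f}) ->
  (forall i x, U x -> is_derive x (delta_mx 0 i) f (df i x)) ->
  (forall i x, U x -> {for x, continuous (df i)}) -> Ck_on 1 U f.
Proof.
move=> cf fdf cdf; split=> [[]//= i _ x /(fdf i)[]//|[_ x /cf//|i []//= _ x Ux]].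
apply: continuous_near_eq (cdf i x Ux).
have : \forall y \near x, U y by exact: open_nbhs_nbhs.
by apply: filterS => y /(fdf i)[_].
Qed.

Lemma Ck1_derive f i x : Ck_on 1 U f -> U x -> is_derive x (delta_mx 0 i) f (partial i f x).
Proof. by move=> [df _] Ux; apply: derivableP; exact: (df [::] i). Qed.

Lemma Ck1_continuous f x : Ck_on 1 U f -> U x -> {for x, continuous f}.
Proof. by move=> [_ cf] Ux; exact: (cf [::]). Qed.

Lemma Ck1_partial_continuous f i x : Ck_on 1 U f -> U x -> {for x, continuous (partial i f)}.
Proof. by move=> [_ cf] Ux; exact: (cf [:: i]). Qed.

Lemma Ck1_cst c : Ck_on 1 U (fun=> c : R).
Proof.
by apply: (@Ck1_intro _ (fun _ _ => 0)) => *; exact: cst_continuous.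
Qed.

Lemma Ck1D f g : Ck_on 1 U f -> Ck_on 1 U g -> Ck_on 1 U (fun x => f x + g x).
Proof.
move=> Cf Cg; apply: (@Ck1_intro _ (fun i x => partial i f x + partial i g x)) => [x Ux|i x Ux|i x Ux].
- by apply: continuousD; exact: Ck1_continuous.
- by apply: is_deriveD; exact: Ck1_derive.
- by apply: continuousD; exact: Ck1_partial_continuous.
Qed.

Lemma Ck1M f g : Ck_on 1 U f -> Ck_on 1 U g -> Ck_on 1 U (fun x => f x * g x).
Proof.
move=> Cf Cg.
apply: (@Ck1_intro _ (fun i x => f x * partial i g x + g x * partial i f x)) => [x Ux|i x Ux|i x Ux].
- by apply: continuousM; exact: Ck1_continuous.
- by apply: is_deriveM; exact: Ck1_derive.
- by apply: continuousD; apply: continuousM; first [exact: Ck1_continuous|exact: Ck1_partial_continuous].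
Qed.

Lemma Ck1_sum (I : finType) (f : I -> 'rV[R]_n -> R) :
  (forall i, Ck_on 1 U (f i)) -> Ck_on 1 U (fun x => \sum_i f i x).
Proof.
move=> Cf; elim: (index_enum I) => [|i s IH].
  by under eq_fun do rewrite big_nil; exact: Ck1_cst.
by under eq_fun do rewrite big_cons; exact: Ck1D.
Qed.

Lemma Ck1_prod (I : finType) (f : I -> 'rV[R]_n -> R) :
  (forall i, Ck_on 1 U (f i)) -> Ck_on 1 U (fun x => \prod_i f i x).
Proof.
move=> Cf; elim: (index_enum I) => [|i s IH].
  by under eq_fun do rewrite big_nil; exact: Ck1_cst.
by under eq_fun do rewrite big_cons; exact: Ck1M.
Qed.

Lemma Ck1_comp (h dh : R -> R) f :
  (forall x, U x -> is_derive (f x) 1 h (dh (f x))) ->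
  (forall x, U x -> {for f x, continuous dh}) ->
  Ck_on 1 U f -> Ck_on 1 U (h \o f).
Proof.
move=> hdh cdh Cf.
apply: (@Ck1_intro _ (fun i x => dh (f x) * partial i f x)) => [x Ux|i x Ux|i x Ux].
- apply: continuous_comp; first exact: Ck1_continuous.
  by apply/differentiable_continuous/derivable1_diffP; case: (hdh x Ux).
- by apply: is_derive_comp1; [exact: hdh|exact: Ck1_derive].
- apply: continuousM; last exact: Ck1_partial_continuous.
  by apply: (@continuous_comp _ _ _ f dh); [exact: Ck1_continuous|exact: cdh].
Qed.

Lemma Ck1_sqrt f : (forall x, U x -> 0 < f x) -> Ck_on 1 U f ->
  Ck_on 1 U (fun x => Num.sqrt (f x)).
Proof.
move=> f0; apply: (@Ck1_comp Num.sqrt (fun t => (2 * Num.sqrt t)^-1)) => x Ux.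
  by apply: is_derive1_sqrt; exact: f0.
apply: continuousV; first by rewrite mulf_neq0 ?gt_eqF ?sqrtr_gt0 ?f0.
by apply: continuousM; [exact: cst_continuous|exact: sqrt_continuous].
Qed.

Lemma Ck1_inv f : (forall x, U x -> f x != 0) -> Ck_on 1 U f -> Ck_on 1 U (fun x => (f x)^-1).
Proof.
move=> f0; apply: (@Ck1_comp (@GRing.inv R) (fun t => - t ^- 2)) => x Ux.
  have := @is_deriveV R id (f x) 1 1 (f0 _ Ux) (is_derive_id _ _).
  by rewrite [_ *: 1]mulr1.
apply: continuousN; apply: continuousV; first by rewrite expf_neq0// f0.
exact: exprn_continuous.
Qed.

Lemma Ck1_det m (A : 'rV[R]_n -> 'M[R]_m) :
  (forall i j, Ck_on 1 U (fun x => A x i j)) -> Ck_on 1 U (fun x => \det (A x)).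
Proof.
move=> CA; rewrite /determinant; apply: Ck1_sum => s.
by apply: Ck1M; [exact: Ck1_cst|exact: Ck1_prod].
Qed.

Lemma Ck1_det_adj m (A : 'rV[R]_n -> 'M[R]_m) : (forall x, U x -> A x \in unitmx) ->
  (forall i j, Ck_on 1 U (fun x => A x i j)) ->
  forall i j, Ck_on 1 U (fun x => (\det (A x))^-1 * \adj (A x) i j).
Proof.
move=> uA CA i j; apply: Ck1M.
  apply: Ck1_inv; last exact: Ck1_det.
  by move=> x /uA; rewrite unitmxE unitfE.
under eq_fun do rewrite mxE /cofactor.
apply: Ck1M; first exact: Ck1_cst.
by apply: Ck1_det => k l; under eq_fun do rewrite !mxE; exact: CA.
Qed.

End Closure.

Section Nondivergence.
Variables (n : nat) (U : set 'rV[R]_n) (G : 'rV[R]_n -> 'M[R]_n).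
Hypotheses (oU : open U) (CG : forall i j, Ck_on 1 U (fun x => G x i j)).
Hypothesis pG : forall x, U x -> posdef (G x).

(** [invmx] is defined by cases; on [U] it agrees with the adjugate formula, which is built from
    sums, products and one inverse, and openness of [U] transfers regularity. *)
Lemma Ck1_inverse_metric i j : Ck_on 1 U (fun x => invmx (G x) i j).
Proof.
have uG x : U x -> G x \in unitmx by move=> /pG; exact: posdef_unit.
have [H1 H2] := Ck1_det_adj oU uG CG i j.
have E x : U x -> invmx (G x) i j = (\det (G x))^-1 * \adj (G x) i j.
  by move=> /uG uGx; rewrite /invmx uGx mxE.
apply: (@Ck1_intro _ _ oU _
  (fun k => partial k (fun x => (\det (G x))^-1 * \adj (G x) i j))).
- move=> x Ux; apply: continuous_near_eq (H2 [::] isT x Ux).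
  have : \forall y \near x, U y by exact: open_nbhs_nbhs.
  by apply: filterS => y /E ->.
- move=> k x Ux.
  apply: (@near_eq_is_derive _ _ _ (fun x => (\det (G x))^-1 * \adj (G x) i j)).
    have : \forall y \near x, U y by exact: open_nbhs_nbhs.
    by apply: filterS => y /E ->.
  exact: (derivableP (H1 [::] k isT x Ux)).
- by move=> k x Ux; exact: (H2 [:: k]).
Qed.

Lemma posdef_sqrt_det x : U x -> 0 < Num.sqrt (\det (G x)).
Proof. by move=> /pG/posdef_det; rewrite sqrtr_gt0. Qed.

(** The coefficient between the two derivatives in the divergence form of the Laplacian. *)
Definition weight (a b : 'I_n) (x : 'rV[R]_n) : R :=
  Num.sqrt (\det (G x)) * invmx (G x) a b.

Lemma Ck1_weight a b : Ck_on 1 U (weight a b).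
Proof.
apply: Ck1M => //; last exact: Ck1_inverse_metric.
by apply: Ck1_sqrt => [//|x /pG/posdef_det//|]; exact: Ck1_det.
Qed.

(** Entry [b] is the Laplacian of the [b]-th coordinate function: what remains when the outer
    derivative of the divergence falls on [weight]. *)
Definition drift (x : 'rV[R]_n) : 'rV[R]_n :=
  \row_b ((Num.sqrt (\det (G x)))^-1 * \sum_a partial a (weight a b) x).

Lemma drift_continuous b x : U x -> {for x, continuous (fun y => drift y 0 b)}.
Proof.
move=> Ux; have -> : (fun y => drift y 0 b) = (fun y =>
    (Num.sqrt (\det (G y)))^-1 * \sum_a partial a (weight a b) y).
  by apply/funext => y; rewrite mxE.
apply: continuousM.
  apply: (@Ck1_continuous n U) => //; apply: Ck1_inv => //.
    by move=> y /posdef_sqrt_det; rewrite lt0r => /andP[].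
  by apply: Ck1_sqrt => [//|y /pG/posdef_det//|]; exact: Ck1_det.
apply: for_continuous_sum => a.
by apply: Ck1_partial_continuous Ux; exact: Ck1_weight.
Qed.

Lemma laplacian_nondivergence u x : Ck_on 2 U u -> U x ->
  laplacian G u x = \tr (invmx (G x) *m hess u x) + gradient_form u x (drift x).
Proof.
move=> Cu Ux; rewrite /laplacian /divergence.
have E a : partial a (fun y => Num.sqrt (\det (G y)) * gradient G u y 0 a) x =
    \sum_b (weight a b x * hess u x a b + partial b u x * partial a (weight a b) x).
  have -> : (fun y => Num.sqrt (\det (G y)) * gradient G u y 0 a) =
      \sum_b (weight a b * partial b u).
    apply/funext => y; rewrite /gradient mxE mulr_sumr fct_sumE.
    by apply: eq_bigr => b _; rewrite [RHS]/GRing.mul/= /weight mulrA.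
  apply: derive_val; apply: is_derive_sum => b.
  rewrite [hess _ _ _ _]mxE.
  exact: (@is_deriveM _ _ (weight a b) (partial b u) x (delta_mx 0 a) _ _
    (Ck1_derive a (Ck1_weight a b) Ux) (Ck1_derive a (Ck_on_partial b Cu) Ux)).
under eq_bigr do rewrite E big_split/=.
rewrite big_split/= mulrDr; congr (_ + _).
  have invs a b : invmx (G x) a b = invmx (G x) b a.
    by case: (posdef_inv (pG Ux)) => E1 _; rewrite -[in LHS]E1 mxE.
  rewrite mxtrace_mulC /mxtrace mulr_sumr; apply: eq_bigr => a _.
  rewrite mxE mulr_sumr; apply: eq_bigr => b _.
  by rewrite /weight !mulrA mulVf ?gt_eqF ?posdef_sqrt_det// mul1r invs mulrC.
rewrite exchange_big /gradient_form mulr_sumr; apply: eq_bigr => b _.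
by rewrite mxE -mulr_sumr; ring.
Qed.

End Nondivergence.

End C1Functions.

(** * Tests at two points, orthonormal frames and the fourth root *)

Section Preliminaries.
Context {R : realType}.

(** Both points move with the same parameter [h], so a one-variable test suffices. Weights [1, -1]
    serve the doubling of variables, weights [0, - tau] a single point. *)
Lemma second_order_two_points n (U : set 'rV[R]_n) u x y v w (s t c : R) :
  open U -> Ck_on 2 U u -> U x -> U y ->
  (\forall h \near (0 : R),
    s * (u (x + h *: v) + u (x - h *: v) - 2 * u x) +
    t * (u (y + h *: w) + u (y - h *: w) - 2 * u y) <= c * h ^+ 2) ->
  s * metric_form (hess u x) v + t * metric_form (hess u y) w <= c.
Proof.
move=> oU Cu Ux Uy H.
apply: (@second_order_test _
  (s *: (fun h => u (x + h *: v)) + t *: (fun h => u (y + h *: w)))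
  (fun h => s *: gradient_form u (x + h *: v) v + t *: gradient_form u (y + h *: w) w)).
- move: (C2_line v oU Cu Ux) (C2_line w oU Cu Uy); apply: filterS2 => h dx dy.
  exact: (is_deriveD (is_deriveZ s dx) (is_deriveZ t dy)).
- have dx := C2_line_second v oU Cu Ux; have dy := C2_line_second w oU Cu Uy.
  exact: (is_deriveD (is_deriveZ s dx) (is_deriveZ t dy)).
- move: H; apply: filterS => h; apply: le_trans; rewrite le_eqVlt; apply/orP; left.
  apply/eqP; rewrite !fctE /= !scale0r !addr0 !scaleNr /GRing.scale/=.
  ring.
Qed.

Lemma first_order_point n (U : set 'rV[R]_n) u x v (s c C : R) :
  open U -> Ck_on 2 U u -> U x ->
  (\forall h \near (0 : R), 0 < h -> s * (u (x + h *: v) - u x) <= c * h + C * h ^+ 2) ->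
  s * gradient_form u x v <= c.
Proof.
move=> oU Cu Ux H.
apply: (@first_order_test _ (s *: (fun h => u (x + h *: v))) _ c C).
  exact: (is_deriveZ s (C2_line0 v oU Cu Ux)).
move: H; apply: filterS => h H h0; rewrite !fctE scale0r addr0 -scalerBr.
exact: H.
Qed.

Lemma metric_form_continuous n (G : 'M[R]_n) (x0 : 'rV[R]_n) :
  continuous (fun x : 'rV[R]_n => metric_form G (x - x0)).
Proof.
move=> x; have -> : (fun x : 'rV[R]_n => metric_form G (x - x0)) = (fun x =>
    \sum_j \sum_i (x 0 i - x0 0 i) * G i j * (x 0 j - x0 0 j)).
  apply/funext => y; rewrite metric_form_sum; apply: eq_bigr => j _.
  by apply: eq_bigr => i _; rewrite !mxE.
have cB k : {for x, continuous (fun y : 'rV[R]_n => y 0 k - x0 0 k)}.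
  by apply: continuousB; [exact: coord_continuous|exact: cst_continuous].
apply: for_continuous_sum => j; apply: for_continuous_sum => i.
apply: continuousM; last exact: cB.
by apply: continuousM; [exact: cB|exact: cst_continuous].
Qed.

Lemma norm_le_form n (G : 'M[R]_n) : posdef G ->
  exists2 al, 0 < al & forall (v : 'rV[R]_n) (r : R), 0 <= r ->
    metric_form G v <= r ^+ 2 -> `|v| <= al * r.
Proof.
move=> pG; have ige0 := posdef_inv_diag pG.
pose al := \sum_i invmx G i i.
have al0 : 0 <= al by apply: sumr_ge0.
exists (al + 1) => [|v r r0 vr]; first by lra.
apply: norm_le_coord => [|i]; first by rewrite mulr_ge0//; lra.
rewrite -(@ler_pXn2r _ 2)// ?nnegrE//; last by rewrite mulr_ge0//; lra.
rewrite -normrX ger0_norm ?sqr_ge0// exprMn mulrC.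
apply: le_trans (coord_le_form v i pG) _; apply: ler_pM => //; first exact: posdef_ge0.
have : invmx G i i <= al by rewrite /al (bigD1 i)//= lerDl sumr_ge0.
have := ige0 i; nra.
Qed.

Lemma form_ball_compact n (G : 'M[R]_n) (x0 : 'rV[R]_n) (r : R) : posdef G ->
  compact [set x : 'rV[R]_n | metric_form G (x - x0) <= r].
Proof.
move=> pG; apply: bounded_closed_compact; last first.
  have -> : [set x : 'rV[R]_n | metric_form G (x - x0) <= r] =
      (fun x : 'rV[R]_n => metric_form G (x - x0)) @^-1` [set s | s <= r] by [].
  apply: preimage_closed; last exact: closed_le.
  by move=> x _; exact: metric_form_continuous.
have [al al0 alP] := norm_le_form pG.
have r1 : 0 <= `|r| + 1 by rewrite addr_ge0.
exists (`|x0| + al * (`|r| + 1)); split; first exact: num_real.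
move=> M hM x /= xr; apply: le_trans (ltW hM).
rewrite -[x](subrK x0) addrC (le_trans (ler_normD _ _))// lerD2l.
apply: alP => //; apply: (le_trans xr); apply: (le_trans (ler_norm r)).
by have := normr_ge0 r; nra.
Qed.

Lemma near_form_ball n (G : 'M[R]_n) (x0 x v : 'rV[R]_n) (r : R) :
  metric_form G (x - x0) < r ->
  \forall h \near (0 : R), metric_form G (x + h *: v - x0) <= r /\
                           metric_form G (x - h *: v - x0) <= r.
Proof.
move=> xr.
have xN : \forall y \near x, metric_form G (y - x0) <= r.
  have /cvgrPdist_lt := @metric_form_continuous n G x0 x.
  have r0 : 0 < r - metric_form G (x - x0) by rewrite subr_gt0.
  move=> /(_ _ r0); apply: filterS => y; rewrite ltr_norml => /andP[h1 _].
  lra.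
have := near_line (- v) xN; have := near_line v xN; apply: filterS2 => h h1.
by rewrite scalerN.
Qed.

Lemma trace_metric_form n (E G V : 'M[R]_n) : E = V^T *m V ->
  \sum_k metric_form G (row k V) = \tr (G *m E).
Proof. by move=> ->; rewrite mxtrace_gram mxtrace_mulC. Qed.

(** Used as Parseval's identity: if [V^T *m V] is [invmx G], the rows of [V] are orthonormal for
    [G], and [metric_form_dual] turns the right side into [metric_form G y]. *)
Lemma sum_bform_sq n (G V : 'M[R]_n) (y : 'rV[R]_n) :
  \sum_k bform G y (row k V) ^+ 2 = metric_form (V^T *m V) (y *m G).
Proof.
rewrite /metric_form !mulmxA -(mulmxA _ V).
have -> : V *m (y *m G)^T = (y *m G *m V^T)^T by rewrite [RHS]trmx_mul trmxK.
rewrite mxE; apply: eq_bigr => k _.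
have -> : bform G y (row k V) = (y *m G *m V^T) 0 k.
  by rewrite /bform mxE [RHS]mxE; apply: eq_bigr => j _; congr (_ * _); rewrite !mxE.
by rewrite [_^T k 0]mxE expr2.
Qed.

Lemma metric_form_dual n (G : 'M[R]_n) y : posdef G ->
  metric_form (invmx G) (y *m G) = metric_form G y.
Proof.
move=> pG; have uG := posdef_unit pG; case: pG => Gs _.
by rewrite /metric_form trmx_mul Gs mulmxK// mulmxA.
Qed.

(* The rows of C' are those of C reflected in the hyperplane G-orthogonal to z,
   which leaves the Gram matrix unchanged. *)
Lemma reflection_gram n (G C : 'M[R]_n) (z : 'rV[R]_n) : posdef G -> z != 0 ->
  invmx G = C^T *m C ->
  exists2 C' : 'M[R]_n, invmx G = C'^T *m C' &
    forall k, row k C - row k C' = (2 * bform G (row k C) z / metric_form G z) *: z.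
Proof.
move=> pG z0 CE; pose s := metric_form G z.
have [p pE] : exists p, p = G *m z^T by exists (G *m z^T).
have s0 : s != 0 by rewrite gt_eqF//; case: pG => _; exact.
have uG := posdef_unit pG.
have As : (invmx G)^T = invmx G by case: (posdef_inv pG).
have zp : z *m p = s%:M by rewrite [LHS]mx11_scalar pE mulmxA.
have Ap : invmx G *m p = z^T by rewrite pE mulKmx.
have pA : p^T *m invmx G = z by rewrite -[LHS]trmxK trmx_mul trmxK As Ap trmxK.
pose K : 'M[R]_n := 1%:M - (2 / s) *: (p *m z).
have KT : K^T = 1%:M - (2 / s) *: (z^T *m p^T).
  by rewrite /K linearB /= linearZ /= trmx_mul trmx1.
exists (C *m K).
  rewrite trmx_mul -mulmxA (mulmxA C^T) -CE mulmxA KT mulmxBl mul1mx -scalemxAl.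
  rewrite -mulmxA pA /K mulmxBr mulmx1 mulmxBl -!scalemxAr -!scalemxAl.
  rewrite !mulmxA Ap -(mulmxA z^T) zp mul_mx_scalar -scalemxAl !scalerA opprB.
  rewrite (_ : 2 / s * (2 / s) * s = 2 / s + 2 / s); last by field.
  by rewrite scalerDl addrK subrK.
move=> k; rewrite row_mul /K mulmxBr mulmx1 opprB addrC subrK.
rewrite -scalemxAr mulmxA [row k C *m p]mx11_scalar mul_scalar_mx scalerA.
by congr (_ *: _); rewrite pE mulmxA mulrAC.
Qed.

(** Evaluated at squared distances, so it is the square root of a distance. *)
Definition root4 (s : R) : R := Num.sqrt (Num.sqrt s).

Lemma root4_ge0 s : 0 <= root4 s. Proof. exact: sqrtr_ge0. Qed.

Lemma root4_gt0 s : 0 < s -> 0 < root4 s.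
Proof. by move=> s0; rewrite /root4 !sqrtr_gt0. Qed.

Lemma root4K s : 0 <= s -> root4 s ^+ 4 = s.
Proof.
by move=> s0; rewrite -[4%N]/(2 * 2)%N exprM !sqr_sqrtr ?sqrtr_ge0.
Qed.

(** Bounds the concavity gain of the doubling from below: two points of the unit ball have squared
    distance at most [4]. *)
Lemma root4_ratio s : 0 < s -> s <= 4 -> 4^-1 <= root4 s / s.
Proof.
move=> s0 s4; rewrite ler_pdivlMr//; have sE := root4K (ltW s0).
have r0 := root4_ge0 s; have [r1|r1] := leP (root4 s) 1; last by lra.
have : root4 s ^+ 4 <= root4 s by rewrite -[leRHS]expr1 ler_wiXn2l.
lra.
Qed.

Lemma root4_continuous : continuous root4.
Proof. by move=> s; apply: continuous_comp; exact: sqrt_continuous. Qed.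

(** A concave function lies below its tangent, and [root4 s / (4 * s)] is the derivative of [root4].
    In terms of the fourth roots [x] and [y] the defect is an explicit nonnegative fraction, so
    [root4] need not be differentiated. *)
Lemma root4_tangent s d : 0 < s -> 0 <= s + d ->
  root4 (s + d) <= root4 s + root4 s / (4 * s) * d.
Proof.
move=> s0 sd0.
have y0 := root4_gt0 s0; have x0 := root4_ge0 (s + d).
have yE := root4K (ltW s0); have xE := root4K sd0.
have dE : d = root4 (s + d) ^+ 4 - root4 s ^+ 4 by rewrite yE xE addrC addKr.
set x := root4 (s + d) in x0 xE dE *; set y := root4 s in y0 yE dE *.
rewrite -{1}yE {1}dE.
rewrite (_ : y + _ = x + (x - y) ^+ 2 * (x ^+ 2 + 2 * x * y + 3 * y ^+ 2) / (4 * y ^+ 3)); last first.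
  by field; rewrite gt_eqF.
rewrite lerDl divr_ge0//; last by rewrite mulr_ge0// exprn_ge0// ltW.
by rewrite mulr_ge0 ?sqr_ge0// !addr_ge0 ?mulr_ge0 ?sqr_ge0// ltW.
Qed.

(* Strict concavity along rays: the term that beats all others in the doubling
   argument. *)
Lemma root4_radial s h : 0 <= s -> `|h| <= 1 ->
  root4 ((1 + h) ^+ 2 * s) + root4 ((1 - h) ^+ 2 * s) - 2 * root4 s <=
  - (root4 s * h ^+ 2 / 4).
Proof.
move=> s0; rewrite ler_norml => /andP[h1 h2].
have E k : 0 <= 1 + k -> root4 ((1 + k) ^+ 2 * s) = root4 s * Num.sqrt (1 + k).
  by move=> k0; rewrite mulrC /root4 sqrtrM// sqrtr_sqr ger0_norm// sqrtrM ?sqrtr_ge0.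
rewrite !E; [|lra|lra].
have hp : 0 <= 1 + h by lra.
have hm : 0 <= 1 - h by lra.
set p := Num.sqrt (1 + h); set q := Num.sqrt (1 - h).
have p0 : 0 <= p by exact: sqrtr_ge0.
have q0 : 0 <= q by exact: sqrtr_ge0.
have pE : p ^+ 2 = 1 + h by rewrite sqr_sqrtr.
have qE : q ^+ 2 = 1 - h by rewrite sqr_sqrtr.
have h4 : h ^+ 2 <= 1 by nra.
(* [p * q] is the square root of [1 - h^2], and [(p + q)^2 = 2 + 2 p q]. *)
have pq : p * q <= 1 - h ^+ 2 / 2.
  rewrite -(@ler_pXn2r _ 2)// ?nnegrE ?mulr_ge0//; last by lra.
  rewrite exprMn pE qE.
  have := sqr_ge0 (h ^+ 2).
  rewrite (_ : (1 - h ^+ 2 / 2) ^+ 2 = 1 - h ^+ 2 + (h ^+ 2) ^+ 2 / 4); last by field.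
  nra.
have : p + q <= 2 - h ^+ 2 / 4.
  rewrite -(@ler_pXn2r _ 2)// ?nnegrE ?(addr_ge0 p0 q0)//; last by lra.
  rewrite sqrrD pE qE (_ : (2 - h ^+ 2 / 4) ^+ 2 = 4 - h ^+ 2 + (h ^+ 2) ^+ 2 / 16); last by field.
  by have := sqr_ge0 (h ^+ 2); rewrite -mulr_natl; nra.
have := root4_ge0 s; nra.
Qed.

End Preliminaries.

(** Subtract the equation at [y] from the one at [x]. The left side is at most
    [m (8 N + 2 - D / 2) <= - 3 m]: of the gain [7/8 D], the remainders cost [D / 8] and the drifts
    [D / 4]. The right side is at least [- 2 m]. *)
Lemma doubling_arith (R : realType) (N m kappa lam D tAx tAy tEx tEy gx gy ux uy : R) :
  0 <= N -> 0 < m -> 7 / 8 <= kappa -> kappa <= 1 -> 0 <= lam -> lam <= 1 ->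
  8 * N + 5 <= D / 2 -> tAx - tAy <= m * (8 * N - D) ->
  tEx <= m * (2^-1 + D / 16) -> - tEy <= m * (2^-1 + D / 16) ->
  gx <= m * (2^-1 + D / 8) -> - gy <= m * (2^-1 + D / 8) ->
  ux - uy <= 2 * m -> 0 <= ux - uy ->
  kappa * tAx + tEx + gx = - lam * ux -> kappa * tAy + tEy + gy = - lam * uy -> False.
Proof.
move=> N0 m0 k1 k2 l0 l1 DN tA tEx' tEy' gx' gy' osc uxy ex ey.
have kA : kappa * (tAx - tAy) <= m * (8 * N - 7 / 8 * D).
  apply: le_trans (ler_wpM2l _ tA) _; first lra.
  rewrite mulrCA ler_wpM2l ?(ltW m0)//.
  have h1 : 0 <= N * (1 - kappa) by rewrite mulr_ge0 ?subr_ge0.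
  have h2 : 0 <= D * (kappa - 7 / 8) by rewrite mulr_ge0 ?subr_ge0//; lra.
  lra.
have lu : lam * (ux - uy) <= 2 * m by apply: le_trans osc; rewrite ler_piMl.
have mD : m * (8 * N + 5) <= m * (D / 2) by rewrite ler_wpM2l// ltW.
lra.
Qed.

Lemma abs_le_of_sqr (R : realType) (B t c : R) : 0 <= c ->
  B ^+ 2 <= t / 64 -> t <= 64 * c ^+ 2 -> `|B| <= c.
Proof.
move=> c0 Bt tc; rewrite -(@ler_pXn2r _ 2)// ?nnegrE// -normrX ger0_norm ?sqr_ge0//; lra.
Qed.

(** * The maximum principle on a ball of radius one *)

(* A ball of radius of order lambda^(-1/2) is rescaled to radius 1 by absorbing the
   factor into the frozen metric G0. The leading coefficients are a = kappa A0 + E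
   with E positive definite and small. *)
Section NormalizedBall.
Context {R : realType} (n : nat).
Variables (U : set 'rV[R]_n) (G0 : 'M[R]_n) (kappa lam : R) (p : 'rV[R]_n).
Variables (u : 'rV[R]_n -> R) (a : 'rV[R]_n -> 'M[R]_n) (b : 'rV[R]_n -> 'rV[R]_n).
Hypotheses (oU : open U) (Cu : Ck_on 2 U u) (pG0 : posdef G0).
Hypotheses (kappa_ge : 7 / 8 <= kappa) (kappa_le1 : kappa <= 1).

Local Notation q := (metric_form G0).
Local Notation A0 := (invmx G0).
Local Notation E x := (a x - kappa *: A0).

Hypothesis ballU : forall x, q (x - p) <= 1 -> U x.
Hypothesis posE : forall x, q (x - p) <= 1 -> posdef (E x).
Hypothesis trE : forall x, q (x - p) <= 1 -> \tr (G0 *m E x) <= 8^-1.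
Hypothesis drift_small : forall x, q (x - p) <= 1 -> q (b x) <= 64^-1.
Hypothesis solution : forall x, q (x - p) <= 1 ->
  \tr (a x *m hess u x) + gradient_form u x (b x) = - lam * u x.

Let q_ge0 v : 0 <= q v. Proof. exact: posdef_ge0. Qed.
Let G0s : G0^T = G0. Proof. by case: pG0. Qed.

Let trA0 : \tr (G0 *m A0) = n%:R.
Proof. by rewrite mulmxV ?posdef_unit// mxtrace1. Qed.

Let tr_split x : \tr (a x *m hess u x) =
  kappa * \tr (A0 *m hess u x) + \tr (E x *m hess u x).
Proof.
rewrite -[in LHS](subrK (kappa *: A0) (a x)) mulmxDl mxtraceD addrC.
by rewrite -scalemxAl mxtraceZ.
Qed.

Let drift_bform x v : q (x - p) <= 1 -> bform G0 v (b x) ^+ 2 <= q v / 64.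
Proof.
move=> xB; apply: le_trans (cauchy_schwarz v (b x) pG0) _.
by rewrite ler_wpM2l// drift_small.
Qed.

Let cu x : q (x - p) <= 1 -> {for x, continuous u}.
Proof. by move=> /ballU Ux; case: Cu => _ /(_ [::]); exact. Qed.

Lemma line_form v w (h : R) : q (v + h *: w) = q v + 2 * h * bform G0 v w + h ^+ 2 * q w.
Proof. by rewrite metric_formD// bformZr metric_formZ; ring. Qed.

(* Barta's argument: compare u with the bump (1 - q)^2 at a maximum point of
   their quotient. *)
Lemma zero_in_ball : lam = (4 * n%:R + 15) ^+ 2 -> exists2 z, q (z - p) <= 1 & u z = 0.
Proof.
move=> lamE; apply: contrapT => noz.
have u0 x : q (x - p) <= 1 -> u x != 0.
  by move=> xB; apply/eqP => ux; apply: noz; exists x.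
(* The square matters near the sphere: it produces the term [- 8 s] below, which leaves a
   contradiction even when [c = 1 - s] is close to [0]. *)
pose w x := (1 - q (x - p)) ^+ 2.
pose B := [set x | q (x - p) <= 1].
have pB : q (p - p) <= 1 by rewrite subrr metric_form0 ler01.
have cw (x : 'rV[R]_n) : {for x, continuous w}.
  have cq : {for x, continuous (fun x : 'rV[R]_n => 1 - q (x - p))}.
    apply: continuousB; first exact: cst_continuous.
    exact: metric_form_continuous.
  have -> : w = (fun x => (1 - q (x - p)) * (1 - q (x - p))).
    by apply/funext => y; rewrite /w expr2.
  by apply: continuousM; exact: cq.
have [|||y /set_mem yB ymax] := @compact_EVT_max _ _ (fun x => w x / `|u x|) B.
- by exists p.
- exact: form_ball_compact.
- apply: continuous_in_subspaceT => x /set_mem xB.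
  apply: continuousM; first exact: cw.
  apply: continuousV; first by rewrite normr_eq0 u0.
  by apply: (@continuous_comp _ _ _ u (@Num.norm R R)); [exact: cu|exact: norm_continuous].
have {}ymax x : q (x - p) <= 1 -> w x / `|u x| <= w y / `|u y|.
  by move=> xB; apply: ymax; exact/mem_set.
have wy0 : 0 < w y.
  have : 0 < w y / `|u y|.
    apply: lt_le_trans (ymax p pB).
    by rewrite /w subrr metric_form0 subr0 expr1n divr_gt0// normr_gt0 u0.
  by rewrite pmulr_lgt0// invr_gt0 normr_gt0 u0.
pose s := q (y - p); pose c := 1 - s.
have c0 : 0 < c.
  have : 0 <= c by rewrite subr_ge0.
  rewrite le_eqVlt => /orP[/eqP cE|//].
  by move: wy0; rewrite /w -/s -/c -cE expr0n ltxx.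
have s0 : 0 <= s by exact: q_ge0.
have ys : q (y - p) < 1 by rewrite -subr_gt0.
(* Dividing by [u y] itself treats both signs of [u] at once: [tau * u] is positive at [y] and
   touches [w] from above there. *)
pose tau := w y / u y.
have quot (W X Y X' Y' : R) : X' / Y' = X / Y -> W / Y * X = W / Y' * X'.
  by move=> H; rewrite mulrAC -mulrA -H mulrA mulrAC.
have touch : \forall x \near y, q (x - p) <= 1 -> w x <= tau * u x.
  have uy := u0 y yB.
  have : \forall x \near y, 0 < u x / u y.
    have cy : {for y, continuous (fun x => u x / u y)}.
      by apply: continuousM; [exact: cu|exact: cst_continuous].
    apply: cvgr_gt cy _ _.
    by rewrite divff.
  apply: filterS => x ux xB.
  have -> : tau * u x = w y / `|u y| * `|u x|.
    have : `|u x / u y| = u x / u y by rewrite ger0_norm ?ltW.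
    by rewrite normf_div; exact: quot.
  by rewrite -ler_pdivrMr ?normr_gt0 ?u0//; exact: ymax.
have tauu : tau * u y = c ^+ 2 by rewrite /tau divfK ?u0.
(* The right side is minus the second derivative of [w] at [y] along [v]. *)
have second v : - tau * metric_form (hess u y) v <= 4 * c * q v - 8 * bform G0 (y - p) v ^+ 2.
  have := @second_order_two_points _ _ U u y y v 0 (- tau) 0 (4 * c * q v - 8 * bform G0 (y - p) v ^+ 2).
  rewrite mul0r addr0; apply => //; try exact: ballU.
  have t1 := near_line v touch; have t2 := near_line (- v) touch.
  have nb := near_form_ball v ys.
  near=> h; rewrite mul0r addr0.
  have [b1 b2] : q (y + h *: v - p) <= 1 /\ q (y - h *: v - p) <= 1 by near: h.
  have : w (y + h *: v) <= tau * u (y + h *: v).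
    by move: b1; near: h.
  have : w (y - h *: v) <= tau * u (y - h *: v).
    by move: b2; rewrite -scalerN; near: h.
  have e1 : q (y + h *: v - p) = s + 2 * h * bform G0 (y - p) v + h ^+ 2 * q v.
    by rewrite addrAC line_form.
  have e2 : q (y - h *: v - p) = s - 2 * h * bform G0 (y - p) v + h ^+ 2 * q v.
    by rewrite addrAC -scaleNr line_form sqrrN mulrN mulNr.
  rewrite /w e1 e2; move: (q v) (bform _ _ _) => Q D h1 h2.
  have -> : - tau * (u (y + h *: v) + u (y - h *: v) - 2 * u y) =
     2 * (tau * u y) - tau * u (y + h *: v) - tau * u (y - h *: v) by ring.
  have := sqr_ge0 (h ^+ 2 * Q); rewrite tauu /c.
  nra.
have first : - tau * gradient_form u y (b y) <= 4 * c * bform G0 (y - p) (b y).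
  set v := b y.
  apply: (@first_order_point _ _ U u y v (- tau) _ (2 * c * q v)) => //; first exact: ballU.
  have t1 := near_line v touch; have nb := near_form_ball v ys.
  near=> h => h0.
  have [b1 _] : q (y + h *: v - p) <= 1 /\ q (y - h *: v - p) <= 1 by near: h.
  have : w (y + h *: v) <= tau * u (y + h *: v).
    by move: b1; near: h.
  rewrite /w addrAC line_form -/s.
  have -> : - tau * (u (y + h *: v) - u y) = tau * u y - tau * u (y + h *: v) by ring.
  rewrite tauu; set Q := q v; set D := bform _ _ _.
  have := sqr_ge0 (2 * h * D + h ^+ 2 * Q); rewrite /c.
  nra.
have [C CE] := cholesky (posdef_inv pG0).
have [V VE] := cholesky (posE yB).
have sumA : - tau * \tr (A0 *m hess u y) <= 4 * c * n%:R - 8 * s.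
  rewrite CE -mxtrace_gram mulr_sumr.
  apply: le_trans (ler_sum _ (fun k _ => second (row k C))) _.
  rewrite sumrB -!mulr_sumr (trace_metric_form _ CE) trA0 sum_bform_sq -CE.
  by rewrite metric_form_dual.
have sumE : - tau * \tr (E y *m hess u y) <= c / 2.
  rewrite VE -mxtrace_gram mulr_sumr.
  apply: le_trans (ler_sum _ (fun k _ => second (row k V))) _.
  rewrite sumrB -!mulr_sumr (trace_metric_form _ VE) sum_bform_sq -VE.
  have := posdef_ge0 ((y - p) *m G0) (posE yB); have := trE yB.
  by nra.
have Bb : bform G0 (y - p) (b y) <= 8^-1.
  have := drift_bform (y - p) yB; rewrite -/s => H.
  have s1 : s <= 1 by [].
  nra.
have := solution yB; rewrite tr_split => /(congr1 (fun t => - tau * t)) eqn.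
have n0 : 0 <= n%:R :> R by [].
(* The remainder [E y] and the drift cost [c / 2] each; [kappa] between [7/8] and [1] costs one of
   the eight [s]. *)
have key : lam * c ^+ 2 <= (4 * n%:R + 1) * c - 7 * s.
  have -> : lam * c ^+ 2 = - tau * (- lam * u y) by rewrite -tauu; ring.
  rewrite -eqn mulrDr mulrDr.
  have : - tau * (kappa * \tr (A0 *m hess u y)) <= 4 * c * n%:R - 7 * s.
    rewrite mulrCA.
    apply: le_trans (ler_wpM2l (le_trans _ kappa_ge) sumA) _ => //.
    have h1 : 0 <= (c * n%:R) * (1 - kappa).
      by rewrite !mulr_ge0 ?subr_ge0 ?(ltW c0).
    have h2 : 0 <= s * (8 * kappa - 7) by rewrite mulr_ge0//; move: kappa_ge; lra.
    lra.
  nra.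
(* Now [lam c^2 <= (4 n + 8) c - 7], whereas [(4 n + 15)^2 c^2 >= (4 n + 15) c - 1/4]. *)
move: key; rewrite lamE; have -> : s = 1 - c by rewrite /c; ring.
have := sqr_ge0 ((4 * n%:R + 15) * c - 2^-1).
nra.
Unshelve. all: by end_near. Qed.

(* Doubling of variables. At a positive maximum of the difference of the two sides
   the second derivatives are tested in directions (xi, eta): for the part
   kappa A0 of a, eta is xi reflected in the hyperplane orthogonal to x - y, so
   that only radial second derivatives of root4 remain; for the parts E x and E y
   the two points are moved independently, and smallness suffices. *)
Lemma doubling_estimate (m : R) : 0 <= lam <= 1 ->
  (forall x, q (x - p) <= 1 -> `|u x| <= m) ->
  forall x y, q (x - p) <= 1 -> q (y - p) <= 1 ->
  u x - u y <= m * (2 * (q (x - p) + q (y - p)) +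
    8 * (8 * n%:R + 5) * root4 (q (x - y))).
Proof.
move=> /andP[lam0 lam1] um.
have [L LE] : exists L : R, L = 8 * (8 * n%:R + 5) by eexists.
rewrite -LE.
pose B := [set x | q (x - p) <= 1].
pose Psi x y := 2 * (q (x - p) + q (y - p)) + L * root4 (q (x - y)).
have pB : q (p - p) <= 1 by rewrite subrr metric_form0 ler01.
have n0 : 0 <= n%:R :> R by [].
have L0 : 0 < L by rewrite LE; lra.
pose F (z : 'rV[R]_n * 'rV[R]_n) := u z.1 - u z.2 - m * Psi z.1 z.2.
have [|||[x y] /set_mem[/= xB yB] zmax] := @compact_EVT_max _ _ F (B `*` B).
- by exists (p, p); split.
- by apply: compact_setX; exact: form_ball_compact.
- apply: continuous_in_subspaceT => -[x y] /set_mem[/= xB yB].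
  have c1 : {for (x, y), continuous (fun z : 'rV[R]_n * 'rV[R]_n => z.1)} by exact: cvg_fst.
  have c2 : {for (x, y), continuous (fun z : 'rV[R]_n * 'rV[R]_n => z.2)} by exact: cvg_snd.
  have cq (f : 'rV[R]_n * 'rV[R]_n -> 'rV[R]_n) x0 : {for (x, y), continuous f} ->
      {for (x, y), continuous (fun z => q (f z - x0))}.
    move=> cf; apply: (@continuous_comp _ _ _ f (fun x => q (x - x0))) => //.
    exact: metric_form_continuous.
  suff : {for (x, y), continuous (fun z : 'rV[R]_n * 'rV[R]_n => u z.1 - u z.2 -
      m * (2 * (q (z.1 - p) + q (z.2 - p)) + L * root4 (q (z.1 - z.2))))} by [].
  apply: continuousB.
    apply: continuousB.
      by apply: (@continuous_comp _ _ _ fst u) => //; exact: cu.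
    by apply: (@continuous_comp _ _ _ snd u) => //; exact: cu.
  apply: continuousM; first exact: cst_continuous.
  apply: continuousD.
    apply: continuousM; first exact: cst_continuous.
    by apply: continuousD; [exact: (cq fst p c1)|exact: (cq snd p c2)].
  apply: continuousM; first exact: cst_continuous.
  apply: (@continuous_comp _ _ _ (fun z : 'rV[R]_n * 'rV[R]_n => q (z.1 - z.2)) root4);
    last exact: root4_continuous.
  have -> : (fun z : 'rV[R]_n * 'rV[R]_n => q (z.1 - z.2)) = (fun z => q (z.1 - z.2 - 0)).
    by apply/funext => z; rewrite subr0.
  exact: (cq (fun z => z.1 - z.2) 0 (continuousB c1 c2)).
have {}zmax x' y' : q (x' - p) <= 1 -> q (y' - p) <= 1 ->
    u x' - u y' - m * Psi x' y' <= u x - u y - m * Psi x y.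
  by move=> x'B y'B; apply: (zmax (x', y')); exact/mem_set.
move=> x' y' x'B y'B; rewrite leNgt; apply/negP => big.
have {big} Fpos : 0 < u x - u y - m * Psi x y.
  by apply: lt_le_trans (zmax x' y' x'B y'B); rewrite subr_gt0.
have osc : u x - u y <= 2 * m.
  have := um x xB; have := um y yB; rewrite !ler_norml.
  by move=> /andP[h1 _] /andP[_ h2]; lra.
have m0 : 0 <= m by apply: le_trans (um p pB).
pose z := x - y.
have [s sE] : exists s : R, s = q z by eexists.
have [W WE] : exists W : R, W = root4 s by eexists.
have W0 : 0 <= W by rewrite WE root4_ge0.
have LW0 : 0 <= L * W by rewrite mulr_ge0// ltW.
have qx0 := q_ge0 (x - p); have qy0 := q_ge0 (y - p).
have FE : m * (2 * (q (x - p) + q (y - p)) + L * W) < u x - u y by rewrite WE sE -subr_gt0.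
(* On the sphere the localising term alone would reach [2 m], the largest possible oscillation;
   hence its factor [2]. *)
have xs : q (x - p) < 1.
  rewrite ltNge; apply/negP => x1.
  have : m * 2 <= m * (2 * (q (x - p) + q (y - p)) + L * W) by rewrite ler_wpM2l//; lra.
  lra.
have ys : q (y - p) < 1.
  rewrite ltNge; apply/negP => y1.
  have : m * 2 <= m * (2 * (q (x - p) + q (y - p)) + L * W) by rewrite ler_wpM2l//; lra.
  lra.
have mPsi0 : 0 <= m * (2 * (q (x - p) + q (y - p)) + L * W).
  by rewrite mulr_ge0//; lra.
have mp : 0 < m by lra.
(* The maximum is off the diagonal, where [root4 (q (x - y))] is smooth and the reflection direction
   is defined. *)
have z0 : z != 0.
  by apply/eqP => /subr0_eq xy; move: FE; rewrite xy subrr ltNge -{1}xy mPsi0.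
have s0 : 0 < s by rewrite sE; case: pG0 => _; apply.
have Wp : 0 < W by rewrite WE root4_gt0.
have s4 : s <= 4.
  have zE : z = (x - p) - (y - p) by rewrite /z opprB addrA subrK.
  have := q_ge0 ((x - p) + (y - p)); rewrite (metric_formD (x - p) (y - p))//.
  rewrite sE zE (metric_formB (x - p) (y - p))//; lra.
have step xi eta : \forall h \near (0 : R),
    (u (x + h *: xi) - u x) - (u (y + h *: eta) - u y) <=
    m * (2 * (2 * h * (bform G0 (x - p) xi + bform G0 (y - p) eta) + h ^+ 2 * (q xi + q eta)) +
         L * (root4 (q (z + h *: (xi - eta))) - W)).
  have nx := near_form_ball xi xs; have ny := near_form_ball eta ys.
  move: nx ny; apply: filterS2 => h [hx _] [hy _].
  have := zmax _ _ hx hy; rewrite /Psi -/z -sE -WE.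
  rewrite (_ : x + h *: xi - (y + h *: eta) = z + h *: (xi - eta)); last first.
    by rewrite /z scalerBr opprD addrACA.
  move: (root4 (q _)) => r; rewrite (addrAC x _ (- p)) (addrAC y _ (- p)) !line_form.
  lra.
(* [P / 4] is the derivative of [root4] at [s]; all gains and losses are measured in [L * P]. *)
have [P PE] : exists P : R, P = W / s by eexists.
have P0 : 0 < P by rewrite PE divr_gt0.
have tangent h zeta : root4 (q (z + h *: zeta)) - W <=
    P / 4 * (2 * h * bform G0 z zeta + h ^+ 2 * q zeta).
  rewrite line_form -addrA lerBlDl -sE.
  have -> : P / 4 = W / (4 * s) by rewrite PE; field; rewrite gt_eqF.
  by rewrite WE; apply: root4_tangent => //; rewrite sE addrA -line_form.
have [Hx HxE] : exists H, H = hess u x := ex_intro _ (hess u x) erefl.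
have [Hy HyE] : exists H, H = hess u y := ex_intro _ (hess u y) erefl.
have second xi eta : metric_form Hx xi - metric_form Hy eta <=
    m * (4 * (q xi + q eta) + L * P / 2 * q (xi - eta)).
  have := @second_order_two_points _ _ U u x y xi eta 1 (-1)
    (m * (4 * (q xi + q eta) + L * P / 2 * q (xi - eta))) oU Cu (ballU xB) (ballU yB).
  rewrite mul1r mulN1r -HxE -HyE; apply.
  move: (step xi eta) (step (- xi) (- eta)); apply: filterS2 => h.
  rewrite !scalerN !metric_formN !bformNr (_ : - xi - - eta = - (xi - eta)); last first.
    by rewrite opprD.
  have t1 := tangent h (xi - eta); have t2 := tangent h (- (xi - eta)).
  move: t1 t2; rewrite metric_formN bformNr.
  move: (root4 _) (root4 _) => r1 r2 t1 t2 H1 H2.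
  have : m * (L * (r1 - W + (r2 - W))) <=
      m * (L * (P / 4 * (2 * (h ^+ 2 * q (xi - eta))))).
    by rewrite ler_wpM2l// ler_wpM2l ?(ltW L0)//; lra.
  move: H1 H2; lra.
have radial xi eta beta : xi - eta = beta *: z ->
    metric_form Hx xi - metric_form Hy eta <=
    m * (4 * (q xi + q eta) - L * W * beta ^+ 2 / 4).
  move=> ze; have := @second_order_two_points _ _ U u x y xi eta 1 (-1)
    (m * (4 * (q xi + q eta) - L * W * beta ^+ 2 / 4)) oU Cu (ballU xB) (ballU yB).
  rewrite mul1r mulN1r -HxE -HyE; apply.
  have nb : \forall h \near (0 : R), `|h * beta| <= 1.
    exists (`|beta| + 1)^-1; first by rewrite /= invr_gt0 ltr_wpDl.
    move=> h /=; rewrite sub0r normrN => /ltW hb.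
    rewrite normrM; apply: le_trans (_ : (`|beta| + 1)^-1 * (`|beta| + 1) <= _).
      by rewrite ler_pM// lerDl.
    by rewrite mulVf// gt_eqF// ltr_wpDl.
  move: nb (step xi eta) (step (- xi) (- eta)); apply: filterS3 => h hb H1 H2.
  move: H2; rewrite !scalerN !metric_formN !bformNr (_ : - xi - - eta = - (xi - eta)); last first.
    by rewrite opprD.
  rewrite ze scalerN scalerA in H1 *.
  have -> : z - (h * beta) *: z = (1 - h * beta) *: z by rewrite scalerBl scale1r.
  rewrite metric_formZ -sE => H2.
  have zz : z + (h * beta) *: z = (1 + h * beta) *: z by rewrite scalerDl scale1r.
  move: H2 H1; rewrite zz metric_formZ -sE.
  have := root4_radial (ltW s0) hb; rewrite -WE.
  move: (root4 _) (root4 _) => r1 r2 t12 H2 H1.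
  have : m * (L * (r1 + r2 - 2 * W)) <= m * (L * (- (W * (h * beta) ^+ 2 / 4))).
    by rewrite ler_wpM2l// ler_wpM2l ?(ltW L0)//; lra.
  move: H1 H2; lra.
have firstx v : gradient_form u x v <=
    m * (4 * bform G0 (x - p) v + L * P / 2 * bform G0 z v).
  have := @first_order_point _ _ U u x v 1 (m * (4 * bform G0 (x - p) v + L * P / 2 * bform G0 z v))
    (m * (2 * q v + L * P / 4 * q v)) oU Cu (ballU xB).
  rewrite mul1r; apply; have := step v 0; apply: filterS => h H h0; move: H.
  rewrite scaler0 !addr0 subrr !subr0 metric_form0 bformr0.
  have := tangent h v; move: (root4 _) => r t1.
  have : m * (L * (r - W)) <= m * (L * (P / 4 * (2 * h * bform G0 z v + h ^+ 2 * q v))).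
    by rewrite ler_wpM2l// ler_wpM2l ?(ltW L0)//; lra.
  lra.
have firsty v : - gradient_form u y v <=
    m * (4 * bform G0 (y - p) v - L * P / 2 * bform G0 z v).
  have := @first_order_point _ _ U u y v (-1) (m * (4 * bform G0 (y - p) v - L * P / 2 * bform G0 z v))
    (m * (2 * q v + L * P / 4 * q v)) oU Cu (ballU yB).
  rewrite mulN1r; apply; have := step 0 v; apply: filterS => h H h0; move: H.
  rewrite scaler0 !addr0 subrr !sub0r metric_form0 bformr0.
  have := tangent h (- v); rewrite metric_formN bformNr; move: (root4 _) => r t1.
  have : m * (L * (r - W)) <= m * (L * (P / 4 * (2 * h * - bform G0 z v + h ^+ 2 * q v))).
    by rewrite ler_wpM2l// ler_wpM2l ?(ltW L0)//; lra.
  lra.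
have LP0 : 0 <= L * P by rewrite mulr_ge0// ltW.
(* Only [x] moves: a row [v] of [V] costs [m (4 + L P / 2) q v], and these [q v] sum to the trace,
   at most [1/8]. *)
have trEx : \tr (E x *m Hx) <= m * (2^-1 + L * P / 16).
  have [V VE] := cholesky (posE xB).
  have sec v : metric_form Hx v <= m * (4 + L * P / 2) * q v.
    have := second v 0.
    rewrite (metric_form0 Hy) (metric_form0 G0) (subr0 v) [_ - 0]subr0 [q v + 0]addr0.
    by move=> H; apply: le_trans H _; rewrite le_eqVlt; apply/orP; left; apply/eqP; field.
  rewrite VE -mxtrace_gram; apply: le_trans (ler_sum _ (fun k _ => sec (row k V))) _.
  rewrite -mulr_sumr (trace_metric_form _ VE).
  have -> : m * (2^-1 + L * P / 16) = m * (4 + L * P / 2) * 8^-1 by field.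
  by rewrite ler_wpM2l ?trE// mulr_ge0//; lra.
have trEy : - \tr (E y *m Hy) <= m * (2^-1 + L * P / 16).
  have [V VE] := cholesky (posE yB).
  have sec v : - metric_form Hy v <= m * (4 + L * P / 2) * q v.
    have := second 0 v.
    rewrite (metric_form0 Hx) (metric_form0 G0) (sub0r v) metric_formN sub0r [0 + q v]add0r.
    by move=> H; apply: le_trans H _; rewrite le_eqVlt; apply/orP; left; apply/eqP; field.
  rewrite VE -mxtrace_gram -sumrN; apply: le_trans (ler_sum _ (fun k _ => sec (row k V))) _.
  rewrite -mulr_sumr (trace_metric_form _ VE).
  have -> : m * (2^-1 + L * P / 16) = m * (4 + L * P / 2) * 8^-1 by field.
  by rewrite ler_wpM2l ?trE// mulr_ge0//; lra.
have trA : \tr (A0 *m Hx) - \tr (A0 *m Hy) <= m * (8 * n%:R - L * P).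
  have [C CE] := cholesky (posdef_inv pG0).
  have [C' C'E CC'] := reflection_gram pG0 z0 CE.
  have -> : \tr (A0 *m Hx) = \sum_k metric_form Hx (row k C).
    by rewrite CE mxtrace_gram.
  have -> : \tr (A0 *m Hy) = \sum_k metric_form Hy (row k C').
    by rewrite C'E mxtrace_gram.
  rewrite -sumrB.
  apply: le_trans (ler_sum _ (fun k _ => radial _ _ _ (CC' k))) _.
  rewrite -mulr_sumr ler_wpM2l// sumrB -mulr_sumr big_split/=.
  rewrite (trace_metric_form _ CE) (trace_metric_form _ C'E) trA0.
  (* By Parseval the squares of the reflection coefficients sum to [4 / s], so the total gain is
     [L W / s = L P]. *)
  have -> : \sum_k L * W * (2 * bform G0 (row k C) z / q z) ^+ 2 / 4 =
      L * P / s * \sum_k bform G0 z (row k C) ^+ 2.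
    rewrite mulr_sumr; apply: eq_bigr => k _; rewrite PE (bformC (row k C))// -sE.
    by field; rewrite gt_eqF.
  rewrite sum_bform_sq -CE metric_form_dual// -sE divfK ?gt_eqF//.
  by rewrite (_ : 4 * (n%:R + n%:R) = 8 * n%:R)//; ring.
have P4 : 4^-1 <= P by rewrite PE WE root4_ratio.
have e8 : 0 < 8^-1 :> R by rewrite invr_gt0.
have e4 : 0 < 4^-1 :> R by rewrite invr_gt0.
have c8 t : t <= 1 -> t <= 64 * 8^-1 ^+ 2 :> R by move=> t1; lra.
have c4 : q z <= 64 * 4^-1 ^+ 2 by rewrite -sE; lra.
have /ler_normlP[_ bx] := abs_le_of_sqr (ltW e8) (drift_bform (x - p) xB) (c8 _ xB).
have /ler_normlP[_ by'] := abs_le_of_sqr (ltW e8) (drift_bform (y - p) yB) (c8 _ yB).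
have /ler_normlP[_ bzx] := abs_le_of_sqr (ltW e4) (drift_bform z xB) c4.
have /ler_normlP[bzy _] := abs_le_of_sqr (ltW e4) (drift_bform z yB) c4.
have gx : gradient_form u x (b x) <= m * (2^-1 + L * P / 8).
  apply: le_trans (firstx (b x)) _; rewrite ler_wpM2l//.
  apply: le_trans (_ : 4 * 8^-1 + L * P / 2 * 4^-1 <= _).
    by rewrite lerD ?ler_wpM2l// divr_ge0.
  by rewrite le_eqVlt; apply/orP; left; apply/eqP; field.
have gy : - gradient_form u y (b y) <= m * (2^-1 + L * P / 8).
  apply: le_trans (firsty (b y)) _; rewrite ler_wpM2l// -mulrN.
  apply: le_trans (_ : 4 * 8^-1 + L * P / 2 * 4^-1 <= _).
    by rewrite lerD ?ler_wpM2l// divr_ge0.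
  by rewrite le_eqVlt; apply/orP; left; apply/eqP; field.
have solx : kappa * \tr (A0 *m Hx) + \tr (E x *m Hx) + gradient_form u x (b x) = - lam * u x.
  by rewrite -(solution xB) HxE; congr (_ + _); rewrite tr_split.
have soly : kappa * \tr (A0 *m Hy) + \tr (E y *m Hy) + gradient_form u y (b y) = - lam * u y.
  by rewrite -(solution yB) HyE; congr (_ + _); rewrite tr_split.
(* [P >= 1/4] gives [L P / 2 >= L / 8], which explains the factor [8] in [L]. *)
have LPle : 8 * n%:R + 5 <= L * P / 2.
  apply: le_trans (_ : L * 4^-1 / 2 <= _); last by rewrite ler_wpM2r// ler_wpM2l// ltW.
  by rewrite LE le_eqVlt; apply/orP; left; apply/eqP; field.
have uxy : 0 <= u x - u y by apply: le_trans (ltW FE).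
exact: (doubling_arith n0 mp kappa_ge kappa_le1 lam0 lam1 LPle trA trEx trEy gx gy osc uxy solx soly).
Qed.

End NormalizedBall.

(** * Estimates in a chart, uniform near a point *)

Section LocalAnalysis.
Context {R : realType}.

Lemma posdef_near n (S : 'rV[R]_n -> 'M[R]_n) x0 :
  (forall i j, {for x0, continuous (fun x => S x i j)}) ->
  (\forall x \near x0, (S x)^T = S x) -> posdef (S x0) -> \forall x \near x0, posdef (S x).
Proof.
move=> cS sS pS; have [e e0 eP] := posdef_perturb pS.
have S0s : (S x0)^T = S x0 by case: pS.
have near_entries : \forall x \near x0, forall ij : 'I_n * 'I_n,
    `|S x ij.1 ij.2 - S x0 ij.1 ij.2| <= e.
  apply: (@filter_forall _ _ _ (nbhs x0)) => -[i j] /=.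
  have /cvgrPdist_le := cS i j.
  by move=> /(_ _ e0); apply: filterS => y; rewrite distrC.
move: sS near_entries; apply: filterS2 => x sx xe.
rewrite -[S x](subrK (S x0)) addrC; apply: eP; first by rewrite linearB /= sx S0s.
by move=> i j; have := xe (i, j); rewrite !mxE.
Qed.

Lemma posdef_form_le n (A B : 'M[R]_n) v : posdef (B - A) -> metric_form A v <= metric_form B v.
Proof.
move=> /posdef_ge0 => /(_ v); rewrite (metric_formE (B - A)) bformDm -scaleN1r bformZm.
by rewrite -!metric_formE mulN1r subr_ge0.
Qed.

Lemma metric_formZm n (A : 'M[R]_n) c v : metric_form (c *: A) v = c * metric_form A v.
Proof. by rewrite !metric_formE bformZm. Qed.

Section Chart.
Variables (n : nat) (U : set 'rV[R]_n) (G : 'rV[R]_n -> 'M[R]_n) (x0 : 'rV[R]_n).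
Hypotheses (oU : open U) (CG : forall i j, Ck_on 1 U (fun x => G x i j)).
Hypotheses (pG : forall x, U x -> posdef (G x)) (Ux0 : U x0).

Local Notation q := (metric_form (G x0)).

Let cG i j : {for x0, continuous (fun x => G x i j)}.
Proof. exact: Ck1_continuous Ux0. Qed.

Let cA i j : {for x0, continuous (fun x => invmx (G x) i j)}.
Proof. by apply: Ck1_continuous Ux0; exact: Ck1_inverse_metric. Qed.

Let nearU : \forall x \near x0, U x.
Proof. exact: open_nbhs_nbhs. Qed.

Lemma metric_comparable : \forall x \near x0,
  forall v, q v <= 4 * metric_form (G x) v /\ metric_form (G x) v <= 4 * q v.
Proof.
have p0 := pG Ux0.
have H1 : \forall x \near x0, posdef (4 *: G x - G x0).
  apply: (@posdef_near _ (fun x => 4 *: G x - G x0)).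
  - move=> i j; have -> : (fun x => (4 *: G x - G x0) i j) = (fun x => 4 * G x i j - G x0 i j).
      by apply/funext => x; rewrite !mxE.
    apply: continuousB; last exact: cst_continuous.
    by apply: continuousM; [exact: cst_continuous|exact: cG].
  - move: nearU; apply: filterS => x /pG[xs _]; case: p0 => s0 _.
    by rewrite linearB /= linearZ /= xs s0.
  - rewrite (_ : _ - _ = 3 *: G x0); first exact: posdefZ.
    by apply/matrixP => i j; rewrite !mxE; ring.
have H2 : \forall x \near x0, posdef (4 *: G x0 - G x).
  apply: (@posdef_near _ (fun x => 4 *: G x0 - G x)).
  - move=> i j; have -> : (fun x => (4 *: G x0 - G x) i j) = (fun x => 4 * G x0 i j - G x i j).
      by apply/funext => x; rewrite !mxE.
    by apply: continuousB; [exact: cst_continuous|exact: cG].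
  - move: nearU; apply: filterS => x /pG[xs _]; case: p0 => s0 _.
    by rewrite linearB /= linearZ /= xs s0.
  - rewrite (_ : _ - _ = 3 *: G x0); first exact: posdefZ.
    by apply/matrixP => i j; rewrite !mxE; ring.
move: H1 H2; apply: filterS2 => x p1 p2 v.
by split; rewrite -metric_formZm; exact: posdef_form_le.
Qed.

(** At [x0] the difference is [(1 - kappa) *: invmx (G x0)], positive definite and of trace
    [(1 - kappa) n] against [G x0]; both strict conditions persist nearby. *)
Lemma inverse_metric_near (kappa : R) : kappa < 1 -> (1 - kappa) * n%:R < 8^-1 ->
  \forall x \near x0, posdef (invmx (G x) - kappa *: invmx (G x0)) /\
    \tr (G x0 *m (invmx (G x) - kappa *: invmx (G x0))) <= 8^-1.
Proof.
move=> k1 k8; have p0 := pG Ux0.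
have E0 : invmx (G x0) - kappa *: invmx (G x0) = (1 - kappa) *: invmx (G x0).
  by rewrite scalerBl scale1r.
have cE i j : {for x0, continuous (fun x => (invmx (G x) - kappa *: invmx (G x0)) i j)}.
  have -> : (fun x => (invmx (G x) - kappa *: invmx (G x0)) i j) =
      (fun x => invmx (G x) i j - kappa * invmx (G x0) i j).
    by apply/funext => x; rewrite !mxE.
  by apply: continuousB; [exact: cA|exact: cst_continuous].
have H1 : \forall x \near x0, posdef (invmx (G x) - kappa *: invmx (G x0)).
  apply: (@posdef_near _ (fun x => invmx (G x) - kappa *: invmx (G x0))) => //.
    move: nearU; apply: filterS => x /pG/posdef_inv[xs _]; case: (posdef_inv p0) => s0 _.
    by rewrite linearB /= linearZ /= xs s0.
  by rewrite E0; apply: posdefZ; [rewrite subr_gt0|exact: posdef_inv].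
have ct : {for x0, continuous (fun x => \tr (G x0 *m (invmx (G x) - kappa *: invmx (G x0))))}.
  have -> : (fun x => \tr (G x0 *m (invmx (G x) - kappa *: invmx (G x0)))) =
     (fun x => \sum_i \sum_j G x0 i j * (invmx (G x) - kappa *: invmx (G x0)) j i).
    by apply/funext => x; rewrite /mxtrace; apply: eq_bigr => i _; rewrite mxE.
  apply: for_continuous_sum => i; apply: for_continuous_sum => j.
  by apply: continuousM; [exact: cst_continuous|exact: cE].
have H2 : \forall x \near x0, \tr (G x0 *m (invmx (G x) - kappa *: invmx (G x0))) < 8^-1.
  apply: cvgr_lt ct _ _.
  by rewrite E0 -scalemxAr mulmxV ?posdef_unit// mxtraceZ mxtrace1.
move: H1 H2; apply: filterS2 => x p1 /ltW t1.
by split.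
Qed.

Lemma drift_near : \forall x \near x0, q (drift G x) <= q (drift G x0) + 1.
Proof.
have cd : {for x0, continuous (fun x => q (drift G x))}.
  have -> : (fun x => q (drift G x)) =
      (fun x => \sum_j \sum_i drift G x 0 i * G x0 i j * drift G x 0 j).
    by apply/funext => x; rewrite metric_form_sum.
  apply: for_continuous_sum => j; apply: for_continuous_sum => i.
  apply: continuousM; last exact: (drift_continuous oU CG pG).
  by apply: continuousM; [exact: (drift_continuous oU CG pG)|exact: cst_continuous].
have H : \forall x \near x0, q (drift G x) < q (drift G x0) + 1.
  by apply: cvgr_lt cd _ _; rewrite ltrDl.
by move: H; apply: filterS => x /ltW.
Qed.

End Chart.

End LocalAnalysis.

Section LocalEstimates.
Context {R : realType}.

Lemma local_estimates n (U : set 'rV[R]_n) (G : 'rV[R]_n -> 'M[R]_n) (x0 : 'rV[R]_n) :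
  open U -> (forall i j, Ck_on 1 U (fun x => G x i j)) ->
  (forall x, U x -> posdef (G x)) -> U x0 ->
  let q := metric_form (G x0) in
  let K : R := 4 * n%:R + 15 in
  exists d Lam : R, [/\ 0 < d, 0 < Lam,
    forall x, `|x0 - x| < d -> U x /\
      forall v, q v <= 4 * metric_form (G x) v /\ metric_form (G x) v <= 4 * q v &
    forall p lam, `|x0 - p| < d / 2 -> Lam <= lam ->
      (forall x, q (x - p) <= K ^+ 2 / lam -> `|x0 - x| < d) /\
      forall u, Ck_on 2 U u -> (forall x, U x -> laplacian G u x + lam * u x = 0) ->
        (exists2 z, q (z - p) <= K ^+ 2 / lam & u z = 0) /\
        forall m y, (forall x, U x -> `|u x| <= m) -> q (y - p) <= lam^-1 ->
          `|u p - u y| <= m * (2 * (lam * q (y - p)) +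
                               8 * (8 * n%:R + 5) * root4 (lam * q (y - p)))].
Proof.
move=> oU CG pG Ux0 q K.
have pG0 := pG x0 Ux0.
have n0 : 0 <= n%:R :> R by [].
have K1 : 1 <= K by rewrite /K; lra.
pose kappa : R := 1 - (16 * (n%:R + 1))^-1.
have kE : (16 * (n%:R + 1)) * (1 - kappa) = 1.
  by rewrite /kappa subKr mulfV//; lra.
have k1 : kappa < 1 by rewrite ltrBlDl ltrDr invr_gt0; lra.
have k78 : 7 / 8 <= kappa by move: kE k1; clearbody kappa; nra.
have k8 : (1 - kappa) * n%:R < 8^-1 by move: kE k1; clearbody kappa; nra.
have [al al0 alP] := norm_le_form pG0.
have /nbhs_ballP[d /= d0 dP] : nbhs x0 [set x | [/\ U x,
    forall v, q v <= 4 * metric_form (G x) v /\ metric_form (G x) v <= 4 * q v,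
    posdef (invmx (G x) - kappa *: invmx (G x0)),
    \tr (G x0 *m (invmx (G x) - kappa *: invmx (G x0))) <= 8^-1 &
    q (drift G x) <= q (drift G x0) + 1]].
  have h1 : \forall x \near x0, U x by exact: open_nbhs_nbhs.
  have h2 := metric_comparable oU CG pG Ux0.
  have h3 := inverse_metric_near oU CG pG Ux0 k1 k8.
  have h4 := drift_near oU CG pG Ux0.
  have h34 : \forall x \near x0, [/\ posdef (invmx (G x) - kappa *: invmx (G x0)),
    \tr (G x0 *m (invmx (G x) - kappa *: invmx (G x0))) <= 8^-1 &
    q (drift G x) <= q (drift G x0) + 1].
    by move: h3 h4; apply: filterS2 => x [? ?] ?; split.
  by move: h1 h2 h34; apply: filterS3 => x ? ? [? ? ?]; split.
have {}dP x : `|x0 - x| < d -> [/\ U x,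
    forall v, q v <= 4 * metric_form (G x) v /\ metric_form (G x) v <= 4 * q v,
    posdef (invmx (G x) - kappa *: invmx (G x0)),
    \tr (G x0 *m (invmx (G x) - kappa *: invmx (G x0))) <= 8^-1 &
    q (drift G x) <= q (drift G x0) + 1].
  by move=> xd; apply: dP; rewrite -ball_normE.
pose be := q (drift G x0) + 1.
have be0 : 0 < be by rewrite ltr_wpDl// posdef_ge0.
(* The first summand brings the rescaled drift below [1/64]; the second keeps the ball of squared
   radius [K^2 / lam] within [d / 2] of its centre. *)
pose Lam := 64 * K ^+ 2 * be + 4 * al ^+ 2 * K ^+ 2 / d ^+ 2.
have K20 : 0 < K ^+ 2 by rewrite exprn_gt0//; lra.
have L1 : 0 < 64 * K ^+ 2 * be by rewrite mulr_gt0// mulr_gt0.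
have L2 : 0 < 4 * al ^+ 2 * K ^+ 2 / d ^+ 2 by rewrite divr_gt0 ?exprn_gt0// mulr_gt0// mulr_gt0 ?exprn_gt0.
exists d, Lam; split => //; first exact: (addr_gt0 L1 L2).
  by move=> x /dP[].
move=> p lam pd Ll.
have lam0 : 0 < lam by apply: lt_le_trans Ll; exact: (addr_gt0 L1 L2).
have inball x : q (x - p) <= K ^+ 2 / lam -> `|x0 - x| < d.
  move=> xp; have [r rE] : exists r, r = K / Num.sqrt lam by eexists.
  have sl0 : 0 < Num.sqrt lam by rewrite sqrtr_gt0.
  have r2 : r ^+ 2 = K ^+ 2 / lam by rewrite rE expr_div_n sqr_sqrtr// ltW.
  have r0 : 0 <= r by rewrite rE divr_ge0// ltW//; lra.
  have xr : `|x - p| <= al * r by apply: alP; rewrite // r2.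
  have ar : al * r < d / 2.
    rewrite -(@ltr_pXn2r _ 2)// ?nnegrE ?mulr_ge0 ?divr_ge0 ?(ltW al0) ?(ltW d0)//.
    rewrite exprMn r2 mulrA ltr_pdivrMr// expr_div_n.
    have : 4 * al ^+ 2 * K ^+ 2 / d ^+ 2 < lam by apply: lt_le_trans Ll; rewrite ltrDr.
    rewrite ltr_pdivrMr ?exprn_gt0//; lra.
  apply: (@le_lt_trans _ _ `|(x0 - p) - (x - p)|); first by rewrite opprB addrA subrK.
  apply: le_lt_trans (ler_normB _ _) _; lra.
split => // u Cu eqn.
have scaled s : 0 < s -> s <= K ^+ 2 / lam ->
  [/\ posdef (s^-1 *: G x0), invmx (s^-1 *: G x0) = s *: invmx (G x0) &
    forall x, metric_form (s^-1 *: G x0) (x - p) <= 1 ->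
    [/\ U x, posdef (s *: invmx (G x) - kappa *: invmx (s^-1 *: G x0)),
      \tr ((s^-1 *: G x0) *m (s *: invmx (G x) - kappa *: invmx (s^-1 *: G x0))) <= 8^-1,
      metric_form (s^-1 *: G x0) (s *: drift G x) <= 64^-1 &
      \tr ((s *: invmx (G x)) *m hess u x) + gradient_form u x (s *: drift G x) =
        - (s * lam) * u x]].
  move=> s0 sK; have iE : invmx (s^-1 *: G x0) = s *: invmx (G x0).
    by rewrite invmxZ ?invrK// unitmxZ ?unitfE ?invr_eq0 ?gt_eqF// posdef_unit.
  have pGs : posdef (s^-1 *: G x0) by apply: posdefZ; rewrite ?invr_gt0.
  split => // x; rewrite metric_formZm ler_pdivrMl// mulr1 => xs.
  have [Ux _ pE tE dE] := dP x (inball x (le_trans xs sK)).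
  have EE : s *: invmx (G x) - kappa *: invmx (s^-1 *: G x0) =
      s *: (invmx (G x) - kappa *: invmx (G x0)).
    by rewrite iE scalerBr !scalerA mulrC.
  split => //.
  - by rewrite EE; apply: posdefZ.
  - by rewrite EE -scalemxAl -scalemxAr scalerA mulVf ?gt_eqF// scale1r.
  - rewrite metric_formZm metric_formZ expr2 -mulrA mulKf ?gt_eqF//.
    apply: le_trans (_ : K ^+ 2 / lam * be <= _).
      by rewrite ler_pM// ?(ltW s0)// posdef_ge0.
    rewrite mulrAC ler_pdivrMr//.
    have : 64 * K ^+ 2 * be <= lam by apply: le_trans Ll; rewrite lerDl ltW.
    lra.
  - have := eqn x Ux; rewrite (laplacian_nondivergence oU CG pG Cu Ux) => /eqP.
    rewrite addr_eq0 => /eqP e; rewrite -scalemxAl mxtraceZ.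
    have -> : gradient_form u x (s *: drift G x) = s * gradient_form u x (drift G x).
      by rewrite /gradient_form mulr_sumr; apply: eq_bigr => i _; rewrite mxE mulrA.
    by rewrite -mulrDr e; ring.
split.
  (* At this scale the eigenvalue becomes [K ^+ 2], the value fixed in [zero_in_ball]. *)
  have s0 : 0 < K ^+ 2 / lam by rewrite divr_gt0.
  have [pGs iE nP] := scaled _ s0 (lexx _).
  have [|z zp uz] := @zero_in_ball R n U ((K ^+ 2 / lam)^-1 *: G x0) kappa (K ^+ 2 / lam * lam) p u
    (fun x => (K ^+ 2 / lam) *: invmx (G x)) (fun x => (K ^+ 2 / lam) *: drift G x)
    oU Cu pGs k78 (ltW k1) (fun x xB => let: And5 a _ _ _ _ := nP x xB in a)
    (fun x xB => let: And5 _ a _ _ _ := nP x xB in a)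
    (fun x xB => let: And5 _ _ a _ _ := nP x xB in a)
    (fun x xB => let: And5 _ _ _ a _ := nP x xB in a)
    (fun x xB => let: And5 _ _ _ _ a := nP x xB in a).
    by rewrite divfK// gt_eqF.
  exists z => //; move: zp; rewrite metric_formZm ler_pdivrMl// mulr1.
  exact.
(* At this scale the eigenvalue becomes [1], as [doubling_estimate] allows. *)
have s0 : 0 < lam^-1 by rewrite invr_gt0.
have [|pGs iE nP] := scaled _ s0.
  by rewrite ler_peMl ?(ltW s0)// exprn_ege1.
rewrite invrK in nP pGs iE.
move=> m y um yp.
have osc := @doubling_estimate R n U (lam *: G x0) kappa (lam^-1 * lam) p u
    (fun x => lam^-1 *: invmx (G x)) (fun x => lam^-1 *: drift G x)
    oU Cu pGs k78 (ltW k1) (fun x xB => let: And5 a _ _ _ _ := nP x xB in a)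
    (fun x xB => let: And5 _ a _ _ _ := nP x xB in a)
    (fun x xB => let: And5 _ _ a _ _ := nP x xB in a)
    (fun x xB => let: And5 _ _ _ a _ := nP x xB in a)
    (fun x xB => let: And5 _ _ _ _ a := nP x xB in a) m.
have l1 : lam^-1 * lam = 1 by rewrite mulVf// gt_eqF.
have pp : metric_form (lam *: G x0) (p - p) <= 1 by rewrite subrr metric_form0.
have yB : metric_form (lam *: G x0) (y - p) <= 1.
  by rewrite metric_formZm -ler_pdivlMl// mulr1.
have l01 : 0 <= lam^-1 * lam <= 1 by rewrite l1 ler01 lexx.
have {}osc := osc l01 (fun x xB => um x (let: And5 a _ _ _ _ := nP x xB in a)).
rewrite ler_norml; apply/andP; split.
  rewrite lerNl opprB; have := osc y p yB pp.
  by rewrite subrr metric_form0 addr0 !metric_formZm.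
have := osc p y pp yB.
by rewrite subrr metric_form0 add0r -(opprB y p) metric_formN !metric_formZm.
Qed.

End LocalEstimates.

(** * Geodesic balls and coordinate balls *)

Section Length.
Context {R : realType}.
Local Notation mu := lebesgue_measure.

Lemma continuous_itv01 (f : R -> R) :
  (forall t : R, 0 <= t <= 1 -> {for (t : R), continuous f}) -> {within `[0%R, 1%R], continuous f}.
Proof.
move=> cf; apply: continuous_in_subspaceT => t /set_mem /=; rewrite in_itv /= => tt.
exact: cf.
Qed.

Lemma integrable_itv01 (f : R -> R) :
  (forall t : R, 0 <= t <= 1 -> {for (t : R), continuous f}) ->
  mu.-integrable `[0%R, 1%R] (EFin \o f).
Proof.
move=> cf; apply: continuous_compact_integrable; first exact: segment_compact.
exact: continuous_itv01.
Qed.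

(** [df] may be discontinuous, so it is not integrated: the mean value theorem is applied to
    [S + f], with [S] the primitive of [sp]. *)
Lemma le_integral_speed (f df sp : R -> R) :
  (forall t : R, 0 <= t <= 1 -> {for (t : R), continuous sp}) ->
  (forall t : R, 0 <= t <= 1 -> is_derive (t : R) 1 f (df t)) ->
  (forall t : R, 0 <= t <= 1 -> - df t <= sp t) ->
  ((f 0 - f 1)%:E <= \int[mu]_(t in `[0%R, 1%R]) (sp t)%:E)%E.
Proof.
move=> csp fdf dfsp.
have isp := integrable_itv01 csp.
pose S x := (\int[mu]_(t in `[0%R, x]) sp t)%R.
have cS : {within `[0%R, 1%R], continuous S}.
  exact: (parameterized_integral_continuous ler01 isp).
have dS (x : R) : x \in `]0%R, 1%R[ -> is_derive x 1 S (sp x).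
  rewrite in_itv/= => /andP[x0 x1].
  have x01 : 0 <= x <= 1 by rewrite !ltW.
  have [dx ex] := continuous_FTC1_closed x1 isp x0 (csp x x01).
  by split; [exact: dx|rewrite -derive1E].
have cf : {within `[0%R, 1%R], continuous f}.
  apply: derivable_within_continuous => t; rewrite in_itv/= => tt.
  by case: (fdf t tt).
have [t] := @MVT_segment R (S + f) (fun x => sp x + df x) 0 1 ler01
  (fun x xab => is_deriveD (dS x xab) (fdf x (subset_itv_oo_cc xab)))
  (fun x => continuousD (cS x) (cf x)).
rewrite in_itv/= subr0 mulr1 !fctE => tt E.
have S0 : S 0 = 0 by rewrite /S set_itv1 Rintegral_set1.
have -> : (\int[mu]_(t in `[0%R, 1%R]) (sp t)%:E)%E = (S 1)%:E.
  by rewrite /S /Rintegral fineK// integrable_fin_num.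
rewrite lee_fin; have := dfsp t tt; rewrite S0 in E; lra.
Qed.

Lemma integral_speed_le (sp : R -> R) (c : R) :
  (forall t : R, 0 <= t <= 1 -> {for (t : R), continuous sp}) ->
  (forall t : R, 0 <= sp t) -> (forall t : R, 0 <= t <= 1 -> sp t <= c) ->
  (\int[mu]_(t in `[0%R, 1%R]) (sp t)%:E <= c%:E)%E.
Proof.
move=> csp sp0 spc; have c0 : 0 <= c.
  by apply: le_trans (spc 0 _); rewrite ?lexx ?ler01.
apply: (@le_trans _ _ (\int[mu]_(t in `[0%R, 1%R]) c%:E)%E).
  apply: ge0_le_integral => //.
  - by move=> t _; rewrite lee_fin.
  - by case/integrableP: (integrable_itv01 csp).
rewrite integral_cst//= lebesgue_measure_itv /= lte_fin ltr01 -EFinD subr0 mule1.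
exact: lexx.
Qed.

End Length.

Section Curves.
Context {R : realType}.

Lemma is_derive_curve n (U : set 'rV[R]_n) f (c : R -> 'rV[R]_n) (t : R) v :
  open U -> Ck_on 1 U f -> U (c t) -> is_derive t 1 c v ->
  is_derive t 1 (f \o c) (gradient_form f (c t) v).
Proof.
move=> oU Cf Uct [dc cE]; have [df dfE] := C1_differentiable oU Cf Uct.
have dct : differentiable c t by apply/derivable1_diffP.
have dfc : differentiable (f \o c) t by exact: differentiable_comp.
split; first exact: diff_derivable.
by rewrite deriveE// diff_comp//= dfE -cE deriveE.
Qed.

Lemma is_derive_affine n (x v : 'rV[R]_n) (t : R) :
  is_derive t 1 (fun s : R => x + s *: v) v.
Proof.
have E : h^-1 *: (((fun s : R => x + s *: v) \o shift t) (h *: (1 : R)) - (x + t *: v))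
    @[h --> (0 : R)^'] --> v.
  apply: cvg_near_cst; near=> h => /=.
  have h0 : h != 0 by near: h; exact: nbhs_dnbhs_neq.
  rewrite [_%:A]mulr1 opprD addrACA subrr add0r -scalerBl addrK scalerA mulVf// scale1r.
  by [].
by split; [apply/cvg_ex; exists v; exact: E|apply: cvg_lim; [exact: norm_hausdorff|exact: E]].
Unshelve. all: by end_near. Qed.

Lemma bform_sum n (S : 'M[R]_n) (u v : 'rV[R]_n) :
  bform S u v = \sum_j \sum_i u 0 i * S i j * v 0 j.
Proof.
rewrite /bform mxE; apply: eq_bigr => j _.
by rewrite !mxE mulr_suml.
Qed.

Lemma is_derive_form n (G : 'M[R]_n) (y : R -> 'rV[R]_n) (x0 v : 'rV[R]_n) (t : R) :
  G^T = G -> (forall i : 'I_n, is_derive t 1 (fun s => y s 0 i) (v 0 i)) ->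
  is_derive t 1 (fun s => metric_form G (y s - x0)) (2 * bform G (y t - x0) v).
Proof.
move=> Gs dy.
have db i : is_derive t 1 (fun s => y s 0 i - x0 0 i) (v 0 i).
  have := is_deriveB (dy i) (is_derive_cst (x0 0 i) t 1).
  by rewrite subr0.
have -> : (fun s => metric_form G (y s - x0)) =
    \sum_j \sum_i (fun s => (y s 0 i - x0 0 i) * (G i j * (y s 0 j - x0 0 j))).
  apply/funext => s; rewrite metric_form_sum fct_sumE; apply: eq_bigr => j _.
  by rewrite fct_sumE; apply: eq_bigr => i _; rewrite !mxE mulrA.
have -> : 2 * bform G (y t - x0) v = \sum_j \sum_i
    ((y t 0 i - x0 0 i) * (G i j * v 0 j) + (G i j * (y t 0 j - x0 0 j)) * v 0 i).
  have -> : 2 * bform G (y t - x0) v = bform G (y t - x0) v + bform G v (y t - x0).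
    by rewrite (bformC v)//; ring.
  rewrite !bform_sum -big_split/=; apply: eq_bigr => j _.
  by rewrite -big_split/=; apply: eq_bigr => i _; rewrite !mxE; ring.
apply: is_derive_sum => j; apply: is_derive_sum => i.
exact: (is_deriveM (db i) (is_deriveZ (G i j) (db j))).
Qed.

(** Squaring removes the corner of the positive part at [0], so a bump built from it is
    differentiable along curves that cross its boundary sphere. *)
Lemma is_derive_pos_square (s : R) :
  is_derive s 1 (fun s : R => Num.max 0 s ^+ 2) (2 * Num.max 0 s).
Proof.
have [->|s0|s0] : [\/ s = 0, s < 0 | 0 < s].
  by have [h|h|h] := ltgtP s 0; [apply: Or32|apply: Or33|apply: Or31].
- rewrite maxxx mulr0.
  have E : h^-1 *: (((fun s : R => Num.max 0 s ^+ 2) \o shift 0) (h *: (1 : R)) -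
      Num.max 0 0 ^+ 2) @[h --> (0 : R)^'] --> (0 : R).
    apply/cvgrPdist_le => e e0; exists e => // h /=; rewrite sub0r normrN => he h0.
    rewrite sub0r normrN addr0 [_%:A]mulr1 maxxx expr0n subr0 normrM normfV.
    rewrite ler_pdivrMl ?normr_gt0// normrX expr2.
    have hm : `|Num.max 0 h| <= `|h| by case: (leP 0 h) => // _; rewrite normr0.
    by rewrite ler_pM// (le_trans hm)// ltW.
  by split; [apply/cvg_ex; exists 0; exact: E|apply: cvg_lim; [exact: Rhausdorff|exact: E]].
- apply: (@near_eq_is_derive _ _ _ (cst 0)).
    near=> x; have x0 : x <= 0 by apply: ltW; near: x; exact: lt_nbhsl.
    by rewrite (max_idPl x0) expr0n.
  by rewrite (max_idPl (ltW s0)) mulr0; exact: is_derive_cst.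
- apply: (@near_eq_is_derive _ _ _ (fun s : R => s ^+ 2)).
    near=> x; have x0 : 0 <= x by apply: ltW; near: x; exact: lt_nbhsr.
    by rewrite (max_idPr x0).
  rewrite (max_idPr (ltW s0)).
  have := @is_deriveX _ _ (@id R) 2 s 1 1 (is_derive_id _ _).
  by rewrite /= expr1 [_%:A]mulr1.
Unshelve. all: by end_near. Qed.

End Curves.

(** * Upper and lower bounds for the Riemannian distance *)

Section Distance.
Context {R : realType} (n : nat) (M : topologicalType).
Variables (A : smooth_atlas R n M) (g : riemannian_metric A).

Local Notation ch i := (atlas_chart (i : atlas_index A)).
Local Notation G i := (metric_mx g i).

Lemma metric_posdef i x : chart_img (ch i) x -> posdef (G i x).
Proof. by move=> ix; split; [exact: (Defs.metric_sym g ix)|exact: (Defs.metric_pos g ix)]. Qed.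

Lemma metric_Ck1 i k l : Ck_on 1 (chart_img (ch i)) (fun x => G i x k l).
Proof. exact: (metric_smooth g). Qed.

Definition speed i (c : R -> 'rV[R]_n) (t : R) : R :=
  Num.sqrt (metric_form (G i (c t)) ('D_1 c t)).

Lemma speed_continuous i c (t : R) : chart_arc i c -> 0 <= t <= 1 ->
  {for t, continuous (speed i c)}.
Proof.
move=> [dc cdc ic] t01; have it := ic t t01.
have cc : {for t, continuous c}.
  by apply/differentiable_continuous/derivable1_diffP; exact: dc.
have cD k : {for t, continuous (fun s => ('D_1 c s) 0 k)}.
  by apply: (@continuous_comp _ _ _ (fun s => 'D_1 c s) (fun v : 'rV[R]_n => v 0 k));
    [exact: cdc|exact: coord_continuous].
apply: (@continuous_comp _ _ _ (fun s => metric_form (G i (c s)) ('D_1 c s)) Num.sqrt);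
  last exact: sqrt_continuous.
have -> : (fun s => metric_form (G i (c s)) ('D_1 c s)) =
    (fun s => \sum_l \sum_k ('D_1 c s) 0 k * G i (c s) k l * ('D_1 c s) 0 l).
  by apply/funext => s; rewrite metric_form_sum.
apply: for_continuous_sum => l; apply: for_continuous_sum => k.
apply: continuousM; last exact: cD.
apply: continuousM; first exact: cD.
apply: (@continuous_comp _ _ _ c (fun x => G i x k l)) => //.
exact: Ck1_continuous (metric_Ck1 i k l) it.
Qed.

Lemma segment_dist i (x y : 'rV[R]_n) (c : R) : 0 <= c ->
  (forall t : R, 0 <= t <= 1 -> chart_img (ch i) (x + t *: (y - x)) /\
     metric_form (G i (x + t *: (y - x))) (y - x) <= c ^+ 2) ->
  (riemannian_dist g (chart_param (ch i) x) (chart_param (ch i) y) <= c%:E)%E.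
Proof.
move=> c0 H; pose s (t : R) := x + t *: (y - x).
have ds (t : R) : is_derive t 1 s (y - x).
  exact: is_derive_affine.
have Ds : (fun t => 'D_1 s t) = cst (y - x) by apply/funext => t; case: (ds t).
have arc : chart_arc i s.
  split.
  - by move=> t; case: (ds t).
  - by rewrite Ds; exact: cst_continuous.
  - by move=> t /H[].
apply: (@le_trans _ _ (arc_length g i s + 0)%E).
  apply: ereal_inf_lbound => /=.
  have -> : chart_param (ch i) x = chart_param (ch i) (s 0) by rewrite /s scale0r addr0.
  have -> : chart_param (ch i) y = chart_param (ch i) (s 1).
    by rewrite /s scale1r addrC subrK.
  by apply: curve_cons => //; exact: curve_nil.
rewrite adde0; apply: integral_speed_le.
- by move=> t t01; exact: speed_continuous.
- by move=> t; exact: sqrtr_ge0.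
- move=> t t01; have [_ h] := H t t01.
  have -> : 'D_1 s t = y - x by case: (ds t).
  by rewrite -(ger0_norm c0) -sqrtr_sqr ler_wsqrtr.
Qed.

(* A function supported in a coordinate ball and Lipschitz along all curves: a curve
   from p leaving the ball has length at least r / 8, whichever charts it uses. *)
Section Bump.
Variables (i : atlas_index A) (p : M) (G0 : 'M[R]_n) (r : R).
Hypotheses (hM : hausdorff_space M) (ip : chart_dom (ch i) p) (pG0 : posdef G0) (r0 : 0 < r).
Let xp := chart_coord (ch i) p.
Local Notation q := (metric_form G0).
Hypothesis ball_img : forall x, q (x - xp) <= r ^+ 2 ->
  chart_img (ch i) x /\ forall v, q v <= 4 * metric_form (G i x) v.

(** The divisor [r ^+ 3] gives height [r] at the centre. A slope is [4 m B / r^3] with [m <= r^2]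
    and [B <= 2 r] times the speed, hence at most [8] times the speed. *)
Let bump_coord (x : 'rV[R]_n) : R := Num.max 0 (r ^+ 2 - q (x - xp)) ^+ 2 / r ^+ 3.

Let bump (P : M) : R :=
  if `[< chart_dom (ch i) P >] then bump_coord (chart_coord (ch i) P) else 0.

Let overlap_open j k : open (overlap (ch j) (ch k)).
Proof.
rewrite openE => x [jx kx]; apply: filterI.
  by apply: open_nbhs_nbhs; split => //; exact: chart_img_open.
apply: (chart_param_cont jx); apply: open_nbhs_nbhs; split => //.
exact: chart_dom_open.
Qed.

Let bump_out P : ~ (chart_param (ch i) @` [set x | q (x - xp) <= r ^+ 2]) P -> bump P = 0.
Proof.
rewrite /bump; case: asboolP => // iP nP.
rewrite /bump_coord (max_idPl _) ?expr0n ?mul0r// subr_le0 leNgt; apply/negP => /ltW qP.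
by apply: nP; exists (chart_coord (ch i) P) => //; rewrite chart_coordK.
Qed.

(** The image of the closed coordinate ball is compact, hence closed in the Hausdorff space [M];
    this makes the extension by zero smooth across the edge of the chart. *)
Let near_out P : ~ chart_dom (ch i) P -> \forall Q \near P, bump Q = 0.
Proof.
move=> nP; have cK : closed (chart_param (ch i) @` [set x | q (x - xp) <= r ^+ 2]).
  apply: compact_closed => //; apply: continuous_compact; last exact: form_ball_compact.
  apply: continuous_in_subspaceT => x /set_mem /= xr.
  by apply: chart_param_cont; case: (ball_img xr).
have : nbhs P (~` (chart_param (ch i) @` [set x | q (x - xp) <= r ^+ 2])).
  apply: open_nbhs_nbhs; split; first exact: closed_openC.
  move=> -[x /= xr xP]; apply: nP; rewrite -xP; apply: chart_param_dom.
  by case: (ball_img xr).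
by apply: filterS => Q; exact: bump_out.
Qed.

(** The arc lives in chart [j] and the bump in chart [i]: off chart [i] the derivative is [0], on it
    the chain rule passes through the transition map. *)
Let bump_arc j c (t : R) : chart_arc j c -> 0 <= t <= 1 ->
  exists2 d, is_derive t 1 (fun s => bump (chart_param (ch j) (c s))) d &
    - d <= 8 * speed j c t.
Proof.
move=> [dc cdc jc] t01; have jt := jc t t01.
have cc : {for t, continuous c}.
  by apply/differentiable_continuous/derivable1_diffP; exact: dc.
have cP : {for t, continuous (fun s => chart_param (ch j) (c s))}.
  by apply: continuous_comp => //; exact: chart_param_cont.
have [iP|nP] := pselect (chart_dom (ch i) (chart_param (ch j) (c t))); last first.
  exists 0; last by rewrite oppr0 mulr_ge0// sqrtr_ge0.
  apply: (near_eq_is_derive _ (is_derive_cst (0 : R) t 1)).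
  have := cP _ (near_out nP); rewrite /= => H.
  by near=> s; apply/esym; near: s; exact: H.
have near_dom : \forall s \near t, chart_dom (ch i) (chart_param (ch j) (c s)).
  exact: (cP _ (open_nbhs_nbhs (conj (chart_dom_open (ch i)) iP))).
pose y s := transition (ch j) (ch i) (c s).
pose J := transition_jacobian (ch j) (ch i) (c t).
pose v := 'D_1 c t *m J.
have ov : overlap (ch j) (ch i) (c t) by split.
have dy l : is_derive t 1 (fun s => y s 0 l) (v 0 l).
  have dct : is_derive t 1 c ('D_1 c t) by exact: derivableP.
  have -> : v 0 l = gradient_form (fun x => transition (ch j) (ch i) x 0 l) (c t) ('D_1 c t).
    by rewrite /v mxE; apply: eq_bigr => k _; rewrite mxE.
  exact: (@is_derive_curve R n _ (fun x => transition (ch j) (ch i) x 0 l) c t _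
    (@overlap_open j i) (atlas_smooth j i l 1%N) ov dct).
have G0s : G0^T = G0 by case: pG0.
have dq := is_derive_form xp G0s dy.
have dm := @is_derive1_comp R (fun s => Num.max 0 s ^+ 2)
  (fun s => r ^+ 2 - q (y s - xp)) t _ _ (is_derive_pos_square (r ^+ 2 - q (y t - xp)))
  (is_deriveB (is_derive_cst (r ^+ 2) t 1) dq).
have db := is_deriveZ (r ^+ 3)^-1 dm.
set d := (X in is_derive _ _ _ X) in db.
exists d.
  apply: near_eq_is_derive db; move: near_dom; apply: filterS => s is_.
  rewrite /bump; case: asboolP => // _.
  by rewrite /bump_coord mulrC.
(* The speed is the same in both charts, so the comparison of [q] with the metric of chart [i]
   bounds the slope along any arc. *)
have sp : metric_form (G j (c t)) ('D_1 c t) = metric_form (G i (y t)) v.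
  by rewrite (metric_compat g ov) /metric_form /v trmx_mul !mulmxA.
rewrite /d sub0r mulrN scalerN opprK /GRing.scale/=.
set m := Num.max 0 _; set B := bform _ _ _.
have [mle|mgt] := leP (r ^+ 2 - q (y t - xp)) 0.
  by rewrite /m (max_idPl mle) mulr0 mul0r mulr0 mulr_ge0// sqrtr_ge0.
have mE : m = r ^+ 2 - q (y t - xp) by rewrite /m (max_idPr (ltW mgt)).
have q0 : 0 <= q (y t - xp) by exact: posdef_ge0.
have qr : q (y t - xp) <= r ^+ 2 by rewrite -subr_ge0 ltW.
have [_ /(_ v)] := ball_img qr; rewrite -sp => qv.
have Bb : B <= r * (2 * speed j c t).
  apply: (le_trans (ler_norm _)).
  rewrite -(@ler_pXn2r _ 2)// ?nnegrE ?mulr_ge0 ?sqrtr_ge0 ?(ltW r0)//.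
  rewrite -normrX ger0_norm ?sqr_ge0//.
  apply: (le_trans (cauchy_schwarz _ _ pG0)).
  rewrite !exprMn /speed sqr_sqrtr ?posdef_ge0//; last exact: metric_posdef.
  by rewrite (_ : 2 ^+ 2 = 4 :> R) ?ler_pM ?posdef_ge0//; ring.
have m0 : 0 <= m by rewrite mE ltW.
have mr : m <= r ^+ 2 by rewrite mE lerBlDr lerDl.
have sp0 : 0 <= speed j c t by exact: sqrtr_ge0.
rewrite ler_pdivrMl ?exprn_gt0//.
rewrite (_ : 2 * m * (2 * B) = 4 * (m * B)); last by ring.
rewrite (_ : r ^+ 3 * (8 * speed j c t) = 4 * (r ^+ 2 * (r * (2 * speed j c t)))); last by ring.
rewrite ler_wpM2l//; apply: (le_trans (ler_wpM2l m0 Bb)).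
by rewrite ler_wpM2r// mulr_ge0 ?mulr_ge0// ltW.
Unshelve. all: by end_near. Qed.

Let bump_length P Q L : curve_length g P Q L -> (((bump P - bump Q) / 8)%:E <= L)%E.
Proof.
elim=> {P Q L} [P|j c Q L arc _ IH]; first by rewrite subrr mul0r.
set P1 := chart_param (ch j) (c 1) in IH *; set P0 := chart_param (ch j) (c 0).
have -> : (bump P0 - bump Q) / 8 = (bump P0 - bump P1) / 8 + (bump P1 - bump Q) / 8.
  by rewrite -mulrDl addrA subrK.
rewrite EFinD leeD//.
pose f (s : R) := bump (chart_param (ch j) (c s)).
have df (t : R) : 0 <= t <= 1 -> is_derive t 1 f ('D_1 f t) /\ - 'D_1 f t <= 8 * speed j c t.
  by move=> /(bump_arc arc)[d [fd fE] dle]; split; [exact: derivableP|rewrite fE].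
have := @le_integral_speed R (8^-1 *: f) (fun t => 8^-1 *: 'D_1 f t) (speed j c).
rewrite !fctE /= -scalerBr [_ *: _]mulrC; apply.
- by move=> t; exact: speed_continuous.
- by move=> t /df[h _]; exact: is_deriveZ.
- move=> t /df[_ h]; rewrite -scalerN /GRing.scale/= mulrC ler_pdivrMr//.
  by rewrite mulrC.
Qed.

Lemma geodesic_ball_in_chart :
  geodesic_ball g p (r / 8) `<=` chart_param (ch i) @` [set x | q (x - xp) < r ^+ 2].
Proof.
move=> Q /ereal_inf_lt[L /bump_length pQ Lr].
have bp : bump p = r.
  rewrite /bump; case: asboolP => // _; rewrite /bump_coord -/xp subrr metric_form0 subr0.
  rewrite (max_idPr _) ?sqr_ge0// -exprM -[(2 * 2)%N]/(3 + 1)%N exprD mulrAC mulfV ?mul1r//.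
  by rewrite expf_neq0// gt_eqF.
have : (bump p - bump Q) / 8 < r / 8 by rewrite -lte_fin; exact: le_lt_trans pQ Lr.
rewrite bp ltr_pM2r// ltrBlDr ltrDl /bump; case: asboolP => [iQ|]; last by rewrite ltxx.
rewrite /bump_coord => bQ; exists (chart_coord (ch i) Q); last by rewrite chart_coordK.
rewrite /= -subr_gt0 ltNge; apply/negP => le0; move: bQ.
by rewrite (max_idPl le0) expr0n mul0r ltxx.
Qed.

End Bump.

End Distance.

(** * Inner radii of nodal domains *)

Section Eigenfunctions.
Context {R : realType} (n : nat) (M : topologicalType).
Variables (A : smooth_atlas R n M) (g : riemannian_metric A).
Hypothesis hM : hausdorff_space M.

Local Notation ch i := (atlas_chart (i : atlas_index A)).
Let K : R := 4 * n%:R + 15.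
Let L : R := 8 * (8 * n%:R + 5).
(** Chosen so that [2 tau^4 + L tau <= (L + 2) tau < 1]: the oscillation about a maximum point of
    [|phi|] then stays below the maximum. *)
Let tau : R := (L + 3)^-1.

Lemma eigenfunction_continuous lam phi : eigenfunction g lam phi -> continuous phi.
Proof.
move=> [_ Cphi _] P; have [i iP] := atlas_cover A P.
have near_i : \forall Q \near P, chart_dom (ch i) Q.
  exact: open_nbhs_nbhs (conj (chart_dom_open (ch i)) iP).
suff : {for P, continuous phi} by [].
apply: (@continuous_near_eq R M (local_rep phi i \o chart_coord (ch i)) phi).
  by move: near_i; apply: filterS => Q iQ; rewrite /local_rep /= chart_coordK.
apply: continuous_comp; first exact: chart_coord_cont.
case: (Cphi i) => _ /(_ [::] isT); apply; exact: chart_coord_img.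
Qed.

(** Nearness in [p] and [lam] jointly is the form in which compactness applies. [phi] is quantified
    afterwards, so thresholds do not depend on it, and the radii do not depend on [p0]. *)
Lemma uniform_estimates (p0 : M) : \forall p \near p0 & lam \near +oo,
  forall phi, eigenfunction g lam phi ->
    (exists2 z, (riemannian_dist g p z < ((2 * K + 1) / Num.sqrt lam)%:E)%E & phi z = 0) /\
    ((forall z, `|phi z| <= `|phi p|) -> phi p != 0 ->
      geodesic_ball g p (tau ^+ 2 / 8 / Num.sqrt lam) `<=`
      connected_component (~` (phi @^-1` [set 0])) p).
Proof.
have [i ip0] := atlas_cover A p0.
have n0 : 0 <= n%:R :> R by [].
have K1 : 1 <= K by rewrite /K; lra.
have L3 : 0 < L + 3 by rewrite /L; lra.
have tau0 : 0 < tau by rewrite invr_gt0.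
have tau1 : tau * (L + 3) = 1 by rewrite mulVf// gt_eqF.
set U := chart_img (ch i); set x0 := chart_coord (ch i) p0.
have oU : open U by exact: chart_img_open.
have [d [Lam [d0 Lam0 dU est]]] := local_estimates oU (metric_Ck1 g i)
  (@metric_posdef _ _ _ _ g i) (chart_coord_img ip0).
have pG0 := metric_posdef g (chart_coord_img ip0).
rewrite -/x0 in dU est pG0.
have near_p : \forall p \near p0, chart_dom (ch i) p /\ `|x0 - chart_coord (ch i) p| < d / 2.
  have h1 : \forall p \near p0, chart_dom (ch i) p.
    exact: open_nbhs_nbhs (conj (chart_dom_open (ch i)) ip0).
  have d2 : 0 < d / 2 by rewrite divr_gt0.
  have := chart_coord_cont ip0; move/cvgrPdist_lt => /(_ _ d2) h2.
  by move: h1 h2; apply: filterS2.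
have near_lam : \forall lam \near (+oo : set_system R), Lam <= lam by apply: nbhs_pinfty_ge; exact: num_real.
exists ([set p | chart_dom (ch i) p /\ `|x0 - chart_coord (ch i) p| < d / 2],
        [set lam | Lam <= lam]) => //.
move=> [p lam] [/= [ip pd] lamge] phi [_ Cphi eqn].
have lam0 : 0 < lam by exact: lt_le_trans lamge.
have sl0 : 0 < Num.sqrt lam by rewrite sqrtr_gt0.
have [inball /(_ (local_rep phi i) (Cphi i) (eqn i))[[z zp uz] osc]] := est _ _ pd lamge.
set xp := chart_coord (ch i) p in pd inball zp osc.
have pE : p = chart_param (ch i) xp by rewrite chart_coordK.
have xpU : U xp by exact: chart_coord_img.
pose q := metric_form (metric_mx g i x0).
have segq x (t : R) : 0 <= t <= 1 -> q (xp + t *: (x - xp) - xp) <= q (x - xp).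
  move=> /andP[t0 t1]; rewrite addrC addrA addNr add0r /q metric_formZ ler_piMl ?posdef_ge0//.
  by rewrite expr_le1.
split.
  exists (chart_param (ch i) z) => //; rewrite pE.
  (* The factor [2] comes from comparing the metric with [4 q]; the extra [1] makes the inequality
     strict, as open geodesic balls require. *)
  apply: (@le_lt_trans _ _ (2 * K / Num.sqrt lam)%:E); last first.
    by rewrite lte_fin ltr_pM2r ?invr_gt0// ltrDl.
  apply: segment_dist; first by rewrite !mulr_ge0 ?invr_ge0//; lra.
  move=> t /(segq z) tq; have zt := inball _ (le_trans tq zp).
  split; first by case: (dU _ zt).
  have [_ /(_ (z - xp))[_ h]] := dU _ zt; apply: (le_trans h).
  rewrite expr_div_n exprMn sqr_sqrtr ?(ltW lam0)// -mulrA (_ : 2 ^+ 2 = 4 :> R); last by ring.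
  by rewrite ler_wpM2l.
(* Then [lam r^2 = tau^4], whose fourth root is [tau]. *)
move=> maxp phip; set r := tau ^+ 2 / Num.sqrt lam.
have r0 : 0 < r by rewrite divr_gt0 ?exprn_gt0.
have r2 : r ^+ 2 = tau ^+ 4 / lam by rewrite expr_div_n -exprM sqr_sqrtr// ltW.
have tau_le1 : tau <= 1 by rewrite invf_le1//; rewrite /L; lra.
have tau4 : tau ^+ 4 <= 1 by rewrite expr_le1// ltW.
have K2 : 1 <= K ^+ 2 by rewrite exprn_ege1.
have r2K : r ^+ 2 <= K ^+ 2 / lam.
  by rewrite r2 ler_wpM2r ?invr_ge0 ?(ltW lam0)//; lra.
have nonzero x : q (x - xp) <= r ^+ 2 -> local_rep phi i x != 0.
  move=> xr; have m0 : 0 < `|phi p| by rewrite normr_gt0.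
  have lq : lam * q (x - xp) <= tau ^+ 4 by rewrite -ler_pdivlMl// mulrC -r2.
  have := osc `|phi p| x (fun y _ => maxp _).
  have -> : q (x - xp) <= lam^-1.
    by rewrite -[leRHS]mulr1 ler_pdivlMl// (le_trans lq).
  move=> /(_ isT) H; apply/eqP => ux; move: H.
  rewrite ux subr0 {1}/local_rep /= -pE -/q.
  have lq0 : 0 <= lam * q (x - xp) by rewrite mulr_ge0 ?posdef_ge0// ltW.
  have rt : root4 (lam * q (x - xp)) <= tau.
    rewrite -(@ler_pXn2r _ 4)// ?nnegrE ?root4_ge0 ?(ltW tau0)//.
    by rewrite root4K.
  have tt : tau ^+ 4 <= tau by rewrite -[leRHS]expr1 ler_wiXn2l// ltW.
  rewrite -[leLHS]mulr1 ler_pM2l// => H.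
  have : L * root4 (lam * q (x - xp)) <= L * tau by rewrite ler_wpM2l// /L; lra.
  rewrite -/L in H; move: tau1 tau0; rewrite mulrDr [tau * L]mulrC.
  move: H; lra.
have -> : tau ^+ 2 / 8 / Num.sqrt lam = r / 8 by rewrite /r mulrAC.
have ball_img x : q (x - xp) <= r ^+ 2 -> chart_img (ch i) x /\
    forall v, q v <= 4 * metric_form (metric_mx g i x) v.
  move=> xr; have xd := inball _ (le_trans xr r2K).
  by have [Ux H] := dU _ xd; split => // v; case: (H v).
move=> Q /(geodesic_ball_in_chart hM ip pG0 r0 ball_img)[x /= xr <-].
(* Coordinate balls are star-shaped, so this segment joins [p] to [Q] without meeting a zero. *)
pose path (t : R) := chart_param (ch i) (xp + t *: (x - xp)).
have path_ball (t : R) : 0 <= t <= 1 -> q (xp + t *: (x - xp) - xp) <= r ^+ 2.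
  by move=> /(segq x) h; apply: (le_trans h); exact: ltW.
apply: (@connected_component_max _ _ (path @` `[0, 1]%classic)).
- exists 0; first by rewrite /= in_itv/= lexx ler01.
  by rewrite /path scale0r addr0 -pE.
- move=> P [t /=]; rewrite in_itv/= => t01 <- /= /eqP.
  by apply/negP; exact: nonzero (path_ball t t01).
- apply: connected_continuous_connected; first exact: segment_connected.
  apply: continuous_in_subspaceT => t /set_mem /=; rewrite in_itv/= => t01.
  apply: (@continuous_comp _ _ _ (fun t : R => xp + t *: (x - xp)) (chart_param (ch i))).
    exact: line_continuous.
  by apply: chart_param_cont; case: (ball_img _ (path_ball t t01)).
exists 1; first by rewrite /= in_itv/= lexx ler01.
by rewrite /path scale1r addrC subrK.
Qed.

End Eigenfunctions.

Unset Implicit Arguments.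

Theorem corollary1p5 (R : realType) (n : nat) (n_ge3 : (3 <= n)%N)
  (M : topologicalType) (closedM : closed_manifold M)
  (A : smooth_atlas R n M) (g : riemannian_metric A) :
  exists C1 C2 : R, [/\ 0 < C1, 0 < C2 &
    \forall lambda \near +oo, forall phi : M -> R,
      eigenfunction g lambda phi ->
      exists Omega : set M,
        [/\ nodal_domain phi Omega,
            ((C1 / Num.sqrt lambda)%:E <= inrad g Omega)%E
          & (inrad g Omega <= (C2 / Num.sqrt lambda)%:E)%E]].
Proof.
have [hM cM] := closedM.
have n0 : 0 <= n%:R :> R by [].
pose L : R := 8 * (8 * n%:R + 5); pose tau : R := (L + 3)^-1.
have tau0 : 0 < tau by rewrite invr_gt0 /L; lra.
exists (tau ^+ 2 / 8), (2 * (4 * n%:R + 15) + 1); split.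
- by rewrite divr_gt0// exprn_gt0.
- lra.
have nc := (compact_near_coveringP [set: M]).1 cM R (+oo : set_system R) _ _
  (fun p _ => uniform_estimates g hM p).
have near_pos : \forall lam \near (+oo : set_system R), 0 < lam by apply: nbhs_pinfty_gt; exact: num_real.
have FF : Filter (+oo : set_system R) by exact: _.
move: (nc FF) near_pos; apply: filterS2 => lam {}nc lam0 phi ephi.
have sl0 : 0 < Num.sqrt lam by rewrite sqrtr_gt0.
have [[p1 p1nz] _ _] := ephi.
have [|||p _ pmax] := @compact_EVT_max M R (fun P => `|phi P|) [set: M].
- by exists p1.
- exact: cM.
- apply: continuous_subspaceT => P.
  apply: (@continuous_comp _ _ _ phi (@Num.norm R R)); last exact: norm_continuous.
  exact: (eigenfunction_continuous ephi).
have {}pmax z : `|phi z| <= `|phi p| by apply: pmax; exact: mem_set.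
have pnz : phi p != 0.
  by rewrite -normr_gt0 (lt_le_trans _ (pmax p1))// normr_gt0.
exists (connected_component (~` (phi @^-1` [set 0])) p); split.
- by exists p.
- apply: ereal_sup_ubound; exists (tau ^+ 2 / 8 / Num.sqrt lam) => //; split.
    by rewrite divr_gt0// divr_gt0// exprn_gt0.
  exists p; exact: ((nc p I phi ephi).2 pmax pnz).
(* The centre [p'] is arbitrary: the zero estimate holds around every point of [M], so too large a
   ball would put a zero inside the nodal domain. *)
- apply: ge_ereal_sup => _ [r [r0 [p' p'r]] <-].
  rewrite lee_fin leNgt; apply/negP => rbig.
  have [[z zd z0] _] := nc p' I phi ephi.
  have /connected_component_sub : connected_component (~` (phi @^-1` [set 0])) p z.
    by apply: p'r; apply: lt_trans zd _; rewrite lte_fin.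
  exact.
Qed.
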